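(* Let $1\le \ell<r\le h$ be integers. There is $\varepsilon_0>0$ such that for every $0<\varepsilon<\varepsilon_0$ there is $\mu_0>0$ such that for every $0<\mu<\mu_0$ there is $n_0$ such that the following holds for every integer $n\ge n_0$ with $h\mid n$. Let $H$ be an $r$-graph on $h$ vertices and let $G$ be an $r$-graph on $n$ vertices with $\delta_\ell(G)\ge(\delta^*_\ell(H)+\varepsilon)n^{r-\ell}$. Then for any $\mu$-bounded edge-colouring of $G$ there is a rainbow $H$-factor in $G$.
   Context: An $r$-graph is an $r$-uniform hypergraph. For an $r$-graph $G$ and $L\subseteq V(G)$, the degree of $L$ in $G$ is the number of edges of $G$ containing $L$; the minimum $\ell$-degree $\delta_\ell(G)$ is the minimum degree in $G$ over all $L\subseteq V(G)$ with $|L|=\ell$. Let $H$ be an $r$-graph with $|V(H)|=h$. For an $r$-graph $G$ on $n$ vertices with $h\mid n$, an $H$-factor in $G$ is a set of $n/h$ vertex-disjoint copies of $H$ in $G$ (a copy of $H$ in $G$ is a subgraph of $G$ isomorphic to $H$). For $h\mid n$, let $\delta_\ell(H,n)$ be the minimum $\delta$ such that every $r$-graph $G$ on $n$ vertices with $\delta_\ell(G)>\delta n^{r-\ell}$ has an $H$-factor. The asymptotic $\ell$-degree threshold for $H$-factors is $\delta^*_\ell(H):=\liminf_{k\to\infty}\delta_\ell(H,kh)$. An edge-colouring is an arbitrary assignment of a colour to each edge. An edge-colouring of an $r$-graph on $n$ vertices is $\mu$-bounded if for every colour $c$: (i) there are at most $\mu n^{r-1}$ edges of colour $c$, and (ii)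 for any set $I$ of $r-1$ vertices, there are at most $\mu n$ edges of colour $c$ containing $I$. An $H$-factor is rainbow if all edges in the union of its copies of $H$ have distinct colours. *)

(* Defs.v *)
From HB Require Import structures.
From mathcomp Require Import all_boot all_order all_algebra.
From mathcomp Require Import boolp classical_sets functions reals.
From mathcomp Require Import topology normedtype sequences.

Set Implicit Arguments.
Unset Strict Implicit.
Unset Printing Implicit Defensive.

Import Order.TTheory GRing.Theory Num.Theory.
Local Open Scope ring_scope.

Record hypergraph (r : nat) (V : finType) := Hypergraph {
  edges : {set {set V}};
  edges_uniform : {in edges, forall e : {set V}, #|e| = r}
}.

Definition degree r (V : finType) (G : hypergraph r V) (L : {set V}) : nat :=
  #|[set e in edges G | L \subset e]|.

(* [degree G L <= #|edges G|] for every [L], so the initial value does not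
   affect the minimum unless [V] has no [l]-subset at all. *)
Definition min_degree (l r : nat) (V : finType) (G : hypergraph r V) : nat :=
  \big[minn/#|edges G|]_(L : {set V} | #|L| == l) degree G L.

(* A subgraph is given by its vertex set and its edge set: since [H] may have
   isolated vertices, the edges alone do not determine a copy of [H]. *)
Definition is_copy r (W V : finType) (H : hypergraph r W) (G : hypergraph r V)
    (c : {set V} * {set {set V}}) : Prop :=
  c.2 \subset edges G /\
  exists f : W -> V,
    [/\ injective f, c.1 = f @: [set: W]
      & c.2 = [set f @: (e : {set W}) | e in edges H]].

Definition is_factor r (W V : finType) (H : hypergraph r W) (G : hypergraph r V)
    (T : {set {set V} * {set {set V}}}) : Prop :=
  [/\ forall c, c \in T -> is_copy H G c,
      forall c c', c \in T -> c' \in T -> c != c' -> [disjoint c.1 & c'.1]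
    & #|T| = (#|V| %/ #|W|)%N].

Definition admissible (R : realType) (l r : nat) (W : finType)
    (H : hypergraph r W) (n : nat) (d : R) : Prop :=
  0 <= d /\
  forall (V : finType) (G : hypergraph r V), #|V| = n ->
    d * n%:R ^+ (r - l) < (min_degree l G)%:R -> exists T, is_factor H G T.

(* The infimum is a minimum, see [threshold_at_min].  The condition [0 <= d] in
   [admissible] is automatic when [n] is a positive multiple of [#|W|] and [H]
   has an edge (the edgeless [G] has no [H]-factor); it makes the threshold 0
   when [H] is edgeless. *)
Definition threshold_at (R : realType) (l r : nat) (W : finType)
    (H : hypergraph r W) (n : nat) : R :=
  inf [set d : R | admissible l H n d]%classic.

Definition threshold (R : realType) (l r : nat) (W : finType)
    (H : hypergraph r W) : R :=
  limn_inf (fun k : nat => threshold_at R l H (k * #|W|)).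

(* A colouring is a total function on vertex sets, of which only the values on
   the edges of [G] are ever used. *)
Definition mu_bounded (R : realType) (mu : R) r (V : finType)
    (G : hypergraph r V) (C : eqType) (col : {set V} -> C) : Prop :=
  forall c : C,
    #|[set e in edges G | col e == c]|%:R <= mu * #|V|%:R ^+ (r - 1) /\
    forall I : {set V}, #|I| = (r - 1)%N ->
      #|[set e in edges G | (col e == c) && (I \subset e)]|%:R
        <= mu * #|V|%:R.

Definition rainbow (V : finType) (C : eqType) (col : {set V} -> C)
    (T : {set {set V} * {set {set V}}}) : Prop :=
  {in \bigcup_(c in T) c.2 &, injective col}.

Lemma min_degree_le l r (V : finType) (G : hypergraph r V) :
  (min_degree l G <= #|edges G|)%N.
Proof.
rewrite /min_degree; elim/big_rec: _ => // L x _ lex.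
by rewrite geq_min lex orbT.
Qed.

Lemma min_degreeP l r (V : finType) (G : hypergraph r V) (m : nat) :
  (l <= #|V|)%N ->
  (m <= min_degree l G)%N <->
  (forall L : {set V}, #|L| = l -> (m <= degree G L)%N).
Proof.
move=> lV; split=> [mG L Ll | degG].
  apply: leq_trans mG _; rewrite /min_degree.
  elim: (index_enum _) (mem_index_enum L) => // K s IHs.
  rewrite inE big_cons => /predU1P[<-|/IHs Ls]; first by rewrite Ll eqxx geq_minl.
  by case: ifP => // _; rewrite geq_min Ls orbT.
rewrite /min_degree; elim/big_rec: _ => [|L x /eqP Ll mx]; last first.
  by rewrite leq_min mx degG.
have : (0 < #|[set A : {set V} | #|A| == l]|)%N.
  by rewrite card_draws bin_gt0.
case/card_gt0P=> L; rewrite inE => /eqP /degG /leq_trans; apply.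
by apply: subset_leq_card; apply/fintype.subsetP=> e; rewrite inE => /andP[].
Qed.

Lemma threshold_at_min (R : realType) (l r : nat) (W : finType)
    (H : hypergraph r W) (n : nat) : (0 < n)%N ->
  admissible l H n (threshold_at R l H n) /\
  forall d : R, admissible l H n d -> threshold_at R l H n <= d.
Proof.
move=> n0.
have ne : ([set d : R | admissible l H n d] !=set0)%classic.
  exists (2 ^ (2 ^ n))%:R; split=> // V G Vn; rewrite -natrX -natrM ltr_nat.
  move=> big; exfalso; move: big; apply/negP; rewrite -leqNgt.
  apply: (leq_trans (min_degree_le _ _)).
  have /subset_leq_card : edges G \subset powerset [set: V].
    by apply/fintype.subsetP=> e _; rewrite powersetE finset.subsetT.
  rewrite card_powerset cardsT Vn => /leq_trans; apply.
  apply: (@leq_trans (2 ^ (2 ^ n))); first by rewrite ltnW // ltn_expl.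
  by rewrite leq_pmulr // expn_gt0 n0.
have lb : lbound [set d : R | admissible l H n d]%classic 0 by move=> d [].
split; last by move=> d ad; apply: ge_inf => //; exists 0.
split; first exact: lb_le_inf.
have np : 0 < n%:R ^+ (r - l) :> R by rewrite exprn_gt0 // ltr0n.
move=> V G Vn; rewrite -ltr_pdivlMr // => /(inf_lt ne)[d [_ ad]].
by rewrite ltr_pdivlMr //; exact: ad.
Qed.

(* Main.v *)
Require Import Defs.
From HB Require Import structures.
From mathcomp Require Import all_boot all_order fingroup perm all_algebra.
From mathcomp Require Import boolp classical_sets functions reals.
From mathcomp Require Import topology normedtype sequences exp.
From mathcomp Require Import fintype finset ring lra zify.

(** Why the theorem holds.  Fix a multiple [m] of [h], large in terms of [eps],
    at which the threshold for [H]-factors of order [m] is close to the inferior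
    limit ([threshold_approx]).  Suppose that [m] divides [n], and partition the
    vertices of [G] uniformly at random into blocks of size [m].

    A random block through a given vertex inherits the relative minimum
    [l]-degree of [G] up to a small loss, except with probability exponentially
    small in [m] ([sparse_rare]).  By the choice of [m] a block that does inherit
    it has an [H]-factor ([tiling_of_dense]).  For [mu] small in terms of [m],
    boundedness of the colouring makes two edges of equal colour in one block, or
    in two blocks, comparably unlikely ([card_color_bad], [card_color_clash]).
    These unwanted events still happen a linear number of times on average, so
    an average is not enough to avoid them all.  However each concerns one or
    two blocks only, and a uniform random partition satisfies the lopsided local
    lemma with respect to sharing a vertex: the conditional probability of a
    block is estimated by switching it to any other set through one of its
    points ([swap_count]).  As the events at each vertex have total probability
    below [1 / (8 * m)], some partition avoids all of them ([good_partition]),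
    and the union of arbitrary [H]-factors of its blocks is rainbow
    ([rainbow_tiling]).

    The concentration of degrees is a Chernoff bound.  To see a hypergraph of
    higher uniformity through independent trials, the coordinates of a random
    block are arranged so that almost all tuples of coordinates decompose into
    polynomially many families of pairwise disjoint tuples
    ([dense_of_shifts], [sum_low_induced_degree]).

    If [m] does not divide [n], the remainder is a multiple of [h]; it is
    absorbed by some copies of [H] taken from the factor of one good block, whose
    colours are then forbidden elsewhere ([rainbow_factor_of_admissible]).
    Finally, only finitely many [H] occur up to isomorphism, which makes [mu0] and
    [n0] uniform in [H]. *)

Set Implicit Arguments.
Unset Strict Implicit.
Unset Printing Implicit Defensive.

Import Order.TTheory GRing.Theory Num.Theory numFieldNormedType.Exports.
Local Open Scope ring_scope.

(** * A lopsided local lemma for uniform random choices *)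

(** The probability space is the uniform measure on [Om], and everything is
    phrased by counting.  Independence is replaced by the one-sided condition
    that avoiding events which are not neighbours of [i] does not raise the
    probability of [A i] above [p i].  By induction on the number of avoided
    events, the conditional probability of each event is at most [2 * p i]: the
    neighbours that are avoided have total conditional probability at most
    [1/2], so that avoiding them as well costs at most a factor two. *)
Lemma lopsided_local_lemma (R : realFieldType) (T I : finType) (Om : {set T})
    (A : I -> pred T) (p : I -> R) (nb : rel I) (B : {set I}) :
  Om != set0 -> {in B, forall i, 0 <= p i} -> {in B, forall i, nb i i} ->
  {in B, forall i, \sum_(j in B | nb i j) p j <= 4^-1} ->
  (forall i (S : {set I}), i \in B -> S \subset B ->
     (forall j, j \in S -> ~~ nb i j) ->
     #|[set w in Om | A i w & [forall j in S, ~~ A j w]]|%:R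
       <= p i * #|[set w in Om | [forall j in S, ~~ A j w]]|%:R) ->
  exists2 w, w \in Om & {in B, forall i, ~~ A i w}.
Proof.
move=> Om0 p0 nbii sp lop.
pose av (S : {set I}) := [set w in Om | [forall j in S, ~~ A j w]].
pose hit i (S : {set I}) := [set w in Om | A i w & [forall j in S, ~~ A j w]].
have hitS i (S S' : {set I}) : S' \subset S -> hit i S \subset hit i S'.
  move=> sS; apply/subsetP => w; rewrite !inE => /and3P[-> -> /forall_inP h] /=.
  by apply/forall_inP => j /(subsetP sS); exact: h.
have leR (X Y : {set T}) : X \subset Y -> (#|X|%:R : R) <= #|Y|%:R.
  by move=> h; rewrite ler_nat subset_leq_card.
(* the conditional bound [P(A i | S avoided) <= 2 * p i] *)
have key k : forall S : {set I}, S \subset B -> (#|S| <= k)%N ->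
    {in B, forall i, #|hit i S|%:R <= 2 * p i * #|av S|%:R}.
  elim: k => [|k IH] S SB Sk i iB.
    have S0 : S = set0 by apply/eqP; rewrite -cards_eq0 -leqn0.
    apply: (le_trans (lop i S iB SB _)); first by rewrite S0 => j; rewrite inE.
    by have := p0 _ iB; have : 0 <= (#|av S|%:R : R) by []; rewrite -/(av S); nra.
  pose S1 := [set j in S | nb i j]; pose S2 := S :\: S1.
  have S2S : S2 \subset S by exact: subsetDl.
  have h2 : #|hit i S2|%:R <= p i * #|av S2|%:R :> R.
    apply: lop => //; first exact: subset_trans SB.
    by move=> j; rewrite !inE => /andP[] /[swap] ->.
  have [S10|S1n] := eqVneq S1 set0.
    move: h2; rewrite /S2 S10 setD0 => /le_trans; apply.
    by have := p0 _ iB; have : 0 <= (#|av S|%:R : R) by []; nra.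
  have S2k : (#|S2| <= k)%N.
    rewrite -ltnS; apply: leq_trans Sk; apply: proper_card.
    rewrite properE S2S; apply: contra S1n => h.
    apply/eqP/setP => x; rewrite [RHS]inE; apply/negP => xS1.
    have xS : x \in S by move: xS1; rewrite inE => /andP[].
    by have := subsetP h _ xS; rewrite inE xS1.
  have cov : av S2 \subset av S :|: \bigcup_(j in S1) hit j S2.
    apply/subsetP => w wS2; rewrite inE; case: (boolP (w \in av S)) => //= wS.
    move: (wS2); rewrite inE => /andP[wO /forall_inP w2].
    move: wS; rewrite inE wO /= negb_forall => /existsP[j].
    rewrite negb_imply negbK => /andP[jS Aj].
    apply/bigcupP; exists j; last first.
      by rewrite inE wO Aj; exact/forall_inP.
    by apply: contraLR Aj => jS1; apply: w2; rewrite inE jS1.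
  have avle : #|av S2|%:R <= #|av S|%:R + \sum_(j in S1) 2 * p j * #|av S2|%:R.
    apply: (le_trans (leR _ _ cov)).
    apply: (@le_trans _ _ (#|av S| + #|\bigcup_(j in S1) hit j S2|)%:R).
      by rewrite ler_nat leq_card_setU.
    rewrite natrD lerD2l.
    apply: (@le_trans _ _ (\sum_(j in S1) #|hit j S2|)%:R).
      by rewrite ler_nat; elim/big_rec2: _ => [|j m X _ h];
        rewrite ?cards0 // (leq_trans (leq_card_setU _ _)) ?leq_add2l.
    rewrite natr_sum; apply: ler_sum => j jS1.
    have jS : j \in S by move: jS1; rewrite inE => /andP[].
    by apply: IH => //; [exact: subset_trans SB | exact: (subsetP SB)].
  have sS1 : \sum_(j in S1) p j <= 4^-1.
    apply: le_trans (sp i iB).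
    rewrite [leRHS](bigID (mem S1)) /=.
    rewrite [X in _ <= X + _](_ : _ = \sum_(j in S1) p j).
      rewrite lerDl; apply: sumr_ge0 => j /andP[/andP[jB _] _]; exact: p0.
    apply: eq_bigl => j; rewrite andbC; case: (boolP (j \in S1)) => //= jS1.
    by move: jS1; rewrite inE => /andP[/(subsetP SB) -> ->].
  have : \sum_(j in S1) 2 * p j * #|av S2|%:R = 2 * #|av S2|%:R * \sum_(j in S1) p j.
    by rewrite mulr_sumr; apply: eq_bigr => j _; ring.
  move=> E; rewrite {}E in avle.
  have h1 := leR _ _ (hitS i _ _ S2S).
  have := p0 _ iB; have : 0 <= (#|av S2|%:R : R) by []; have : 0 <= (#|av S|%:R : R) by [].
  move: h1 h2 avle sS1.
  move: (\sum_(j in S1) p j) (p i) (#|av S2|%:R) (#|av S|%:R) (#|hit i S|%:R) (#|hit i S2|%:R).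
  move=> s P a2 a h h' hh' h'P a2a s4 a0 a20 P0.
  have : a2 <= 2 * a by nra.
  nra.
(* adding one avoided event at a time keeps at least half of the outcomes *)
have pos k : forall S : {set I}, S \subset B -> #|S| = k -> (0 < #|av S|)%N.
  elim: k => [|k IH] S SB Sk.
    move/eqP: Sk; rewrite cards_eq0 => /eqP->.
    rewrite [av _](_ : _ = Om) ?card_gt0 //; apply/setP => w; rewrite inE.
    by case: (w \in Om) => //=; apply/forall_inP => j; rewrite inE.
  have /card_gt0P[i iS] : (0 < #|S|)%N by rewrite Sk.
  have iB := subsetP SB _ iS.
  have S'B : S :\ i \subset B by apply: subset_trans SB; exact: subsetDl.
  have S'k : #|S :\ i| = k by apply/eqP; rewrite -eqSS -Sk (cardsD1 i S) iS.
  have a0 := IH _ S'B S'k.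
  have pi4 : p i <= 4^-1.
    apply: le_trans (sp i iB); rewrite (bigD1 i) ?iB ?nbii //= lerDl.
    by apply: sumr_ge0 => j /andP[/andP[jB _] _]; exact: p0.
  have := key k _ S'B; rewrite S'k => /(_ (leqnn _) _ iB) hle.
  have : (#|av (S :\ i)| <= #|av S| + #|hit i (S :\ i)|)%N.
    apply: leq_trans (leq_card_setU _ _); apply: subset_leq_card.
    apply/subsetP => w; rewrite !inE => /andP[-> h]; rewrite h /=.
    case: (boolP (A i w)) => Ai; rewrite ?orbT // orbF.
    apply/forall_inP => j jS; have [->//|ji] := eqVneq j i.
    by move/forall_inP: h; apply; rewrite !inE ji.
  rewrite -(ler_nat R) natrD => h3.
  rewrite -(ltr_nat R).
  have : 0 < #|av (S :\ i)|%:R :> R by rewrite ltr0n.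
  move: h3 hle pi4 (p0 _ iB); rewrite -/(av S).
  by move=> *; nra.
have /card_gt0P[w] := pos _ B (subxx _) erefl.
by rewrite inE => /andP[wO /forall_inP h]; exists w.
Qed.

(** * Random partitions into blocks of equal size *)

(** Exchange the elements of [U :\: U'] with those of [U' :\: U], one
    transposition at a time. *)
Lemma exists_perm_imset (V : finType) (U U' : {set V}) :
  #|U| = #|U'| ->
  exists s : {perm V},
    s @: U = U' /\ forall x, x \notin U :|: U' -> s x = x.
Proof.
move: {2}#|U :\: U'| (erefl #|U :\: U'|) => k.
elim: k U => [|k IH] U Uk UU'.
  exists 1%g; split; last by move=> x _; rewrite perm1.
  have sU : U \subset U' by rewrite -setD_eq0 -cards_eq0 Uk.
  have -> : U = U' by apply/eqP; rewrite eqEcard sU UU' leqnn.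
  by rewrite -[RHS]imset_id; apply: eq_imset => x; rewrite perm1.
have /card_gt0P[a] : (0 < #|U :\: U'|)%N by rewrite Uk.
rewrite inE => /andP[aU' aU].
have /card_gt0P[b] : (0 < #|U' :\: U|)%N.
  by move: (cardsID U U') (cardsID U' U); rewrite setIC; lia.
rewrite inE => /andP[bU bU'].
pose U2 := tperm a b @: U.
have memU2 x : (x \in U2) = (tperm a b x \in U).
  by rewrite -[in LHS](tpermK a b x) mem_imset //; exact: perm_inj.
have U2k : #|U2 :\: U'| = k.
  apply/eqP; rewrite -eqSS -Uk (cardsD1 a (U :\: U')) inE aU' aU add1n eqSS.
  apply/eqP/eq_card => x; rewrite !inE memU2.
  case: tpermP => [->|->|/eqP xa _]; rewrite ?eqxx ?(negPf bU) ?bU' ?andbF //.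
  by rewrite xa.
have U2U' : #|U2| = #|U'| by rewrite card_imset //; exact: perm_inj.
have [s [sU2 sfix]] := IH _ U2k U2U'.
exists (tperm a b * s)%g; split.
  by rewrite -sU2 -imset_comp; apply: eq_imset => x /=; rewrite permM.
move=> x; rewrite inE negb_or => /andP[xU xU'].
have xt : tperm a b x = x.
  by rewrite tpermD //; [apply: contraNneq xU | apply: contraNneq xU'] => <-.
by rewrite permM xt sfix // inE memU2 xt negb_or xU.
Qed.

Definition mparts (m : nat) (V : finType) : {set {set {set V}}} :=
  [set M | partition M [set: V] & [forall U in M, #|(U : {set V})| == m]].

Lemma mpartsP m (V : finType) (M : {set {set V}}) :
  reflect (partition M [set: V] /\ {in M, forall U : {set V}, #|U| = m})
          (M \in mparts m V).
Proof.
rewrite inE; apply: (iffP andP) => -[pM h]; split=> //.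
  by move=> U /(forall_inP h)/eqP.
by apply/forall_inP => U /h/eqP.
Qed.

Lemma mparts_eq m (V : finType) (M : {set {set V}}) (P Q : {set V}) x :
  M \in mparts m V -> P \in M -> Q \in M -> x \in P -> x \in Q -> P = Q.
Proof.
move=> /mpartsP[/partition_trivIset/trivIsetP tM _] PM QM xP xQ.
apply/eqP; apply: contraT => /(tM _ _ PM QM)/pred0P/(_ x).
by rewrite /= xP xQ.
Qed.

Definition relabel (V : finType) (s : {perm V}) (M : {set {set V}}) :=
  [set s @: (X : {set V}) | X in M].

Lemma relabel_inj (V : finType) (s : {perm V}) : injective (relabel s).
Proof. by apply: imset_inj; apply: imset_inj; exact: perm_inj. Qed.

Lemma mparts_relabel m (V : finType) (M : {set {set V}}) (s : {perm V}) :
  M \in mparts m V -> relabel s M \in mparts m V.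
Proof.
have si : injective s by exact: perm_inj.
move=> /mpartsP[pM cM]; apply/mpartsP; split; last first.
  by move=> _ /imsetP[U UM ->]; rewrite card_imset // cM.
have <- : s @: [set: V] = [set: V].
  by apply/eqP; rewrite eqEcard finset.subsetT card_imset ?leqnn.
by rewrite /relabel imset_partition.
Qed.

Lemma imset_perm_fix (V : finType) (s : {perm V}) (P : {set V}) :
  {in P, forall x, s x = x} -> s @: P = P.
Proof.
by move=> h; rewrite -[RHS]imset_id; apply: eq_in_imset => x /h.
Qed.

(** Moving the block [U] to a set [U'] that shares a point with it creates no
    block disjoint from [U]: the only block of the new partition that is
    disjoint from [U] and could be new would have to meet [U'], hence equal [U'],
    but [U'] contains a point of [U]. *)
Lemma mem_relabel m (V : finType) (M : {set {set V}}) (s : {perm V})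
    (U U' : {set V}) v (P : {set V}) :
  M \in mparts m V -> U \in M -> s @: U = U' ->
  (forall x, x \notin U :|: U' -> s x = x) ->
  v \in U -> v \in U' -> [disjoint P & U] ->
  P \in relabel s M -> P \in M.
Proof.
move=> MV UM sU sfix vU vU' PU PM.
have PnU x : x \in P -> x \notin U by move=> xP; rewrite (disjointFr PU xP).
have U'M : U' \in relabel s M by rewrite -sU; exact: imset_f.
have sM := mparts_relabel s MV.
have PU' x : x \in P -> x \notin U'.
  move=> xP; apply/negP => xU'.
  by have := PnU v; rewrite (mparts_eq sM PM U'M xP xU') vU' vU => /(_ isT).
have /imset_perm_fix sP : {in P, forall x, s x = x}.
  by move=> x xP; rewrite sfix // inE negb_or PnU ?PU'.
case/imsetP: PM => Q QM PQ.
suff -> : P = Q by [].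
by apply: (imset_inj (@perm_inj _ s)); rewrite sP.
Qed.

Lemma relabel_stable (V : finType) (M : {set {set V}}) (s : {perm V})
    (U U' P : {set V}) :
  (forall x, x \notin U :|: U' -> s x = x) ->
  [disjoint P & U] -> [disjoint P & U'] -> P \in M -> P \in relabel s M.
Proof.
move=> sfix PU PU' PM; rewrite -(@imset_perm_fix _ s P); first exact: imset_f.
by move=> x xP; rewrite sfix // inE negb_or (disjointFr PU xP) (disjointFr PU' xP).
Qed.

(** With block size [m.+1], the number [m] counts the points of a block other than
    a distinguished one. *)
Lemma card_pointed_sets m (V : finType) (W : {set V}) v :
  v \notin W ->
  #|[set U : {set V} | [&& v \in U, #|U| == m.+1 & [disjoint U & W]]]|
    = 'C(#|V| - #|W|.+1, m).
Proof.
move=> vW.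
have cW : #|~: (v |: W)| = (#|V| - #|W|.+1)%N.
  by rewrite cardsCs setCK cardsU1 vW add1n.
rewrite -cW -cards_draws.
rewrite -[RHS](@card_in_imset _ _ (fun A => v |: A)); last first.
  move=> A A' /=; rewrite !inE => /andP[/subsetP sA _] /andP[/subsetP sA' _].
  have vA : v \notin A by apply/negP => /sA; rewrite !inE eqxx.
  have vA' : v \notin A' by apply/negP => /sA'; rewrite !inE eqxx.
  by move=> e; rewrite -(setU1K vA) e setU1K.
apply: eq_card => U; rewrite inE; apply/and3P/imsetP.
  move=> [vU /eqP Um UW]; exists (U :\ v); last by rewrite setD1K.
  rewrite inE; apply/andP; split; last by move: Um; rewrite (cardsD1 v) vU add1n => -[->].
  apply/subsetP => x; rewrite !inE negb_or => /andP[-> xU].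
  by rewrite (disjointFr UW xU).
move=> [A]; rewrite inE => /andP[/subsetP sA /eqP Am] ->.
have vA : v \notin A by apply/negP => /sA; rewrite !inE eqxx.
rewrite setU11 cardsU1 vA Am; split=> //.
rewrite disjoint_subset; apply/subsetP => x; rewrite !inE.
by case/predU1P => [-> // | /sA]; rewrite !inE negb_or => /andP[].
Qed.

(** Among the partitions satisfying [D], at most one in ['C(#|V| - #|W|.+1, m)]
    contains the block [U]: relabelling turns such a partition into one whose
    block at [v] is an arbitrary prescribed set, and a partition has a single
    block at [v].  The set [W] is a place that the relabelling does not touch. *)
Lemma swap_count m (V : finType) (D : pred {set {set V}}) (U W : {set V}) v :
  v \in U -> #|U| = m.+1 -> [disjoint U & W] ->
  (forall M (s : {perm V}) U', M \in mparts m.+1 V -> U \in M -> D M -> s @: U = U' ->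
     (forall x, x \notin U :|: U' -> s x = x) -> v \in U' ->
     [disjoint U' & W] -> D (relabel s M)) ->
  (#|[set M in mparts m.+1 V | (U \in M) && D M]| * 'C(#|V| - #|W|.+1, m)
     <= #|[set M in mparts m.+1 V | D M]|)%N.
Proof.
move=> vU Um UW stab.
pose KK := [set U' : {set V} | [&& v \in U', #|U'| == m.+1 & [disjoint U' & W]]].
pose N U' := [set M in mparts m.+1 V | ((U' : {set V}) \in M) && D M].
rewrite -(card_pointed_sets m (_ : v \notin W)); last by rewrite (disjointFr UW).
have NU U' : U' \in KK -> (#|N U| <= #|N U'|)%N.
  rewrite inE => /and3P[vU' /eqP U'm U'W].
  have [|s [sU sfix]] := @exists_perm_imset V U U'; first by rewrite U'm.
  rewrite -(card_imset _ (@relabel_inj _ s)); apply: subset_leq_card.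
  apply/subsetP => _ /imsetP[M + ->]; rewrite inE => /and3P[MV UM DM].
  rewrite inE mparts_relabel //= -{1}sU imset_f //=.
  exact: (stab _ _ _ MV UM DM sU).
rewrite mulnC -sum_nat_const; apply: (@leq_trans (\sum_(U' in KK) #|N U'|)); first exact: leq_sum.
under eq_bigr do rewrite -sum1_card.
(* a partition is counted once, because it has only one block at [v] *)
rewrite (exchange_big_dep (mem [set M in mparts m.+1 V | D M])) /=; last first.
  by move=> U' M _; rewrite !inE => /and3P[-> _ ->].
rewrite -[leqRHS]sum1_card; apply: leq_sum => M; rewrite inE => /andP[MV DM].
rewrite sum1_card; apply/card_le1_eqP => U1 U2.
move=> /andP[k1 n1] /andP[k2 n2]; move: k1 n1 k2 n2; rewrite !inE.
move=> /and3P[v1 _ _] /and3P[_ M1 _] /and3P[v2 _ _] /and3P[_ M2 _].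
by rewrite (mparts_eq MV M1 M2 v1 v2).
Qed.

Lemma mparts_neq0 m (V : finType) : (0 < m)%N -> (m %| #|V|)%N -> mparts m V != set0.
Proof.
move=> m0 mV.
suff H k : forall A : {set V}, #|A| = (k * m)%N ->
    exists2 M : {set {set V}}, partition M A & {in M, forall U : {set V}, #|U| = m}.
  have [|M pM cM] := H (#|V| %/ m)%N [set: V]; first by rewrite divnK // cardsT.
  by apply/set0Pn; exists M; apply/mpartsP.
elim: k => [|k IH] A Ak.
  exists set0; last by move=> U; rewrite inE.
  by move/eqP: Ak; rewrite cards_eq0 => /eqP->; rewrite partition_set0.
have [U [UA Um]] : exists U : {set V}, U \subset A /\ #|U| = m.
  have : (0 < #|[set U : {set V} | U \subset A & #|U| == m]|)%N.
    by rewrite cards_draws bin_gt0 Ak mulSn leq_addr.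
  by case/card_gt0P => U; rewrite inE => /andP[? /eqP]; exists U.
have [|M pM cM] := IH (A :\: U).
  by rewrite cardsDS // Ak Um mulSn addKn.
exists (U |: M); last by move=> X /setU1P[-> // | /cM].
rewrite -(setID A U) (setIidPr UA); apply: partitionU1 => //.
  by rewrite -card_gt0 Um.
by rewrite -setI_eq0; apply/eqP/setP => x; rewrite !inE; case: (x \in U).
Qed.

(** The local lemma for the uniform random partition into blocks.  The bad
    events are: a bad set is a block, or the two sets of a bad pair are both
    blocks; two events are neighbours when they share a vertex.  [1 / K1] and
    [1 / (K1 * K2)] bound the probabilities of these events, by one or two
    applications of [swap_count], also after conditioning on avoiding events
    that lie elsewhere.  An event has at most [2 * m.+1] vertices, so it suffices
    that the events at each vertex have total probability at most
    [1 / (8 * m.+1)]. *)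
Lemma good_partition (R : realFieldType) m (V : finType)
    (b1 : pred {set V}) (b2 : rel {set V})
    (K1 := 'C(#|V|.-1, m)) (K2 := 'C(#|V|.-1 - m.+1, m)) :
  (m.+1 %| #|V|)%N -> (0 < K2)%N -> symmetric b2 ->
  (forall v,
     #|[set U : {set V} | [&& #|U| == m.+1, v \in U & b1 U]]|%:R / K1%:R
     + 2 * #|[set u : {set V} * {set V} |
            [&& #|u.1| == m.+1, #|u.2| == m.+1, v \in u.1, [disjoint u.1 & u.2]
              & b2 u.1 u.2]]|%:R / (K1 * K2)%:R <= (8 * m.+1%:R)^-1 :> R) ->
  exists M, [/\ M \in mparts m.+1 V, {in M, forall U, ~~ b1 U}
    & {in M &, forall U U', U != U' -> ~~ b2 U U'}].
Proof.
move=> mV K20 b2s hyp.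
have K1_0 : (0 < K1)%N.
  by move: K20; rewrite !bin_gt0 => /leq_trans; apply; exact: leq_subr.
(* the pair [(U, U)] encodes the event that the single set [U] is a block *)
pose p (u : {set V} * {set V}) : R :=
  if u.1 == u.2 then (K1%:R)^-1 else ((K1 * K2)%:R)^-1.
pose A (u : {set V} * {set V}) : pred {set {set V}} :=
  fun M => (u.1 \in M) && (u.2 \in M).
pose nb (u w : {set V} * {set V}) := ~~ [disjoint (u.1 :|: u.2) & (w.1 :|: w.2)].
pose B := [set u : {set V} * {set V} | [&& #|u.1| == m.+1, #|u.2| == m.+1 &
   if u.1 == u.2 then b1 u.1 else [disjoint u.1 & u.2] && b2 u.1 u.2]].
have p0 u : 0 <= p u by rewrite /p; case: ifP => _; rewrite invr_ge0.
have vsum v : \sum_(w in B | v \in w.1 :|: w.2) p w <= (8 * m.+1%:R)^-1.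
  apply: le_trans (hyp v).
  pose Q := [set u : {set V} * {set V} | [&& #|u.1| == m.+1, #|u.2| == m.+1,
     v \in u.1, [disjoint u.1 & u.2] & b2 u.1 u.2]].
  pose swp (u : {set V} * {set V}) := (u.2, u.1).
  have swpI : injective swp by case=> ? ? [? ?] [-> ->].
  rewrite -/Q (bigID (fun w => w.1 == w.2)) /=; apply: lerD.
    rewrite (eq_bigr (fun=> (K1%:R)^-1)); last first.
      by move=> w /andP[_ h]; rewrite /p h.
    rewrite sumr_const -[leLHS]mulr_natl ler_wpM2r ?invr_ge0 // ler_nat.
    rewrite -(@card_imset _ _ (fun U : {set V} => (U, U))); last by move=> ? ? [].
    apply: subset_leq_card; apply/subsetP => -[u u'].
    move=> /andP[/andP[uB vu] /eqP /= e]; subst u'.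
    rewrite /= setUid in vu; move: uB; rewrite inE /= => /and3P[um _ h].
    by apply/imsetP; exists u; rewrite // inE um vu; move: h; rewrite eqxx.
  rewrite (eq_bigr (fun=> ((K1 * K2)%:R)^-1)); last first.
    by move=> w /andP[_ /negPf h]; rewrite /p h.
  rewrite sumr_const -[leLHS]mulr_natl ler_wpM2r ?invr_ge0 // -natrM ler_nat.
  rewrite mul2n -addnn -{2}(card_imset Q swpI); apply: leq_trans (leq_card_setU _ _).
  apply: subset_leq_card; apply/subsetP => -[u u'].
  move=> /andP[/andP[]]; rewrite !inE /= => + + /= ne.
  rewrite (negPf ne) => /and3P[um u'm]  /andP[dis b] /orP[vu|vu'].
    by rewrite um u'm vu dis b.
  apply/orP; right; apply/imsetP; exists (u', u) => //.
  by rewrite inE /= um u'm vu' disjoint_sym dis b2s b.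
have [||||i S iB SB hS|M MV hM] :=
    @lopsided_local_lemma R _ _ (mparts m.+1 V) A p nb B.
- exact: mparts_neq0.
- by move=> u _; exact: p0.
- move=> u; rewrite inE /nb => /and3P[/eqP um _ _].
  by rewrite -setI_eq0 setIid setU_eq0 negb_and -card_gt0 um.
- move=> u uB.
  apply: (@le_trans _ _ (\sum_(v in u.1 :|: u.2) (8 * m.+1%:R)^-1)).
    apply: (@le_trans _ _
       (\sum_(v in u.1 :|: u.2) \sum_(w in B | v \in w.1 :|: w.2) p w)).
      rewrite (exchange_big_dep (mem B)) /=; last by move=> ? ? _ /andP[].
      rewrite big_mkcondr /=; apply: ler_sum => w wB; case: ifP => [|_].
        rewrite /nb -setI_eq0 => /set0Pn[v]; rewrite inE => /andP[vu vw].
        rewrite (bigD1 v) /= ?vu ?wB ?vw // lerDl.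
        by apply: sumr_ge0.
      by apply: sumr_ge0.
    by apply: ler_sum => v _; exact: vsum.
  rewrite sumr_const -[leLHS]mulr_natl.
  have : (#|u.1 :|: u.2| <= 2 * m.+1)%N.
    apply: leq_trans (leq_card_setU _ _) _.
    by move: uB; rewrite inE => /and3P[/eqP-> /eqP-> _]; rewrite mul2n addnn.
  rewrite -(ler_nat R) natrM => h.
  by rewrite ler_pdivrMr ?mulr_gt0 ?ltr0n //; apply: le_trans h _; lra.
- move: (iB); rewrite inE => /and3P[/eqP i1m /eqP i2m ib].
  have Sdis w : w \in S -> [disjoint i.1 :|: i.2 & w.1 :|: w.2].
    by move=> /hS; rewrite negbK.
  pose av M := [forall j in S, ~~ A j M].
  (* relabelling inside the vertices of [i] cannot create an event of [S] *)
  have avstab M (s : {perm V}) (U U' : {set V}) v : M \in mparts m.+1 V -> U \in M -> av M ->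
      s @: U = U' -> (forall x, x \notin U :|: U' -> s x = x) ->
      v \in U -> v \in U' -> U \subset i.1 :|: i.2 -> av (relabel s M).
    move=> MV UM avM sU sfix vU vU' Ui; apply/forall_inP => w wS.
    move/forall_inP: avM => /(_ w wS); apply: contra => /andP[w1 w2].
    have /subset_trans : w.1 \subset w.1 :|: w.2 by exact: subsetUl.
    have dw : [disjoint w.1 :|: w.2 & U].
      by rewrite disjoint_sym; apply: disjointWl (Sdis _ wS).
    move=> _; apply/andP; split.
      by apply: (mem_relabel MV UM sU sfix vU vU' _ w1); apply: disjointWl dw; exact: subsetUl.
    by apply: (mem_relabel MV UM sU sfix vU vU' _ w2); apply: disjointWl dw; exact: subsetUr.
  have i1 : (0 < #|i.1|)%N by rewrite i1m.
  have i2 : (0 < #|i.2|)%N by rewrite i2m.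
  case/card_gt0P: i1 => v1 v1i; case/card_gt0P: i2 => v2 v2i.
  have d0 (X : {set V}) : [disjoint X & set0] by rewrite -setI_eq0 setI0.
  have c2 := @swap_count m V av i.2 set0 v2 v2i i2m (d0 _).
  have {}c2 : (#|[set M in mparts m.+1 V | (i.2 \in M) && av M]| * K1 <=
      #|[set M in mparts m.+1 V | av M]|)%N.
    rewrite /K1 -subn1; move: c2; rewrite cards0; apply.
    move=> M s U' MV UM avM sU sfix vU' _.
    exact: (avstab M s _ U' v2 MV UM avM sU sfix v2i vU' (subsetUr _ _)).
  rewrite /p; case: eqP => [e|/eqP ne].
    rewrite mulrC ler_pdivlMr ?ltr0n // -natrM ler_nat.
    apply: leq_trans c2; rewrite leq_mul2r; apply/orP; right.
    by apply: subset_leq_card; apply/subsetP => M; rewrite !inE /A e andbb.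
  move: ib; rewrite (negPf ne) => /andP[dis _].
  pose D : pred {set {set V}} := fun M => (i.2 \in M) && av M.
  have := @swap_count m V D i.1 i.2 v1 v1i i1m dis.
  have -> : (#|V| - #|i.2|.+1 = #|V|.-1 - m.+1)%N by rewrite i2m; lia.
  rewrite -/K2 => c1.
  rewrite mulrC ler_pdivlMr ?ltr0n ?muln_gt0 ?K1_0 // -natrM ler_nat.
  apply: leq_trans c2; rewrite [(K1 * _)%N]mulnC mulnA leq_mul2r; apply/orP; right.
  apply: leq_trans (c1 _).
    rewrite leq_mul2r; apply/orP; right; apply: subset_leq_card; apply/subsetP => M.
    by rewrite !inE /A /D /av -!andbA.
  move=> M s U' MV UM /andP[i2M avM] sU sfix vU' U'W; apply/andP; split.
    by apply: (relabel_stable sfix _ _ i2M); rewrite disjoint_sym.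
  exact: (avstab M s _ U' v1 MV UM avM sU sfix v1i vU' (subsetUl _ _)).
exists M; split=> // [U UM|U U' UM U'M UU'].
  apply/negP => bU; have /mpartsP[_ cM] := MV.
  have /hM : (U, U) \in B by rewrite inE /= !cM // !eqxx.
  by rewrite /A UM.
apply/negP => bU; have /mpartsP[/partition_trivIset/trivIsetP tM cM] := MV.
have /hM : (U, U') \in B by rewrite inE /= !cM // !eqxx (negPf UU') bU tM.
by rewrite /A UM U'M.
Qed.

(** * Blocks with a colour conflict *)

Lemma ffact_leq_exp n k : (n ^_ k <= n ^ k)%N.
Proof.
elim: k => [|k IH]; first by rewrite ffactn0 expn0.
by rewrite ffactnSr expnSr leq_mul // leq_subr.
Qed.

Lemma bin_leq_exp n k : ('C(n, k) <= n ^ k)%N.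
Proof.
apply: leq_trans (ffact_leq_exp n k).
by rewrite -bin_ffact leq_pmulr // fact_gt0.
Qed.

Lemma card_bigcup_le (I T : finType) (P : pred I) (F : I -> {set T}) :
  (#|\bigcup_(i | P i) F i| <= \sum_(i | P i) #|F i|)%N.
Proof.
elim/big_rec2: _ => [|i k X _ h]; first by rewrite cards0.
by rewrite (leq_trans (leq_card_setU _ _)) // leq_add2l.
Qed.

Lemma card_supersets (V : finType) (S : {set V}) k :
  (#|[set U : {set V} | S \subset U & #|U| == k]| <= #|V| ^ (k - #|S|))%N.
Proof.
apply: leq_trans (bin_leq_exp _ _); rewrite -card_draws.
rewrite -(@card_in_imset _ _ (fun U => U :\: S)); last first.
  move=> U U'; rewrite !inE => /andP[SU _] /andP[SU' _] e.
  by rewrite -(setID U S) -(setID U' S) e (setIidPr SU) (setIidPr SU').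
apply: subset_leq_card; apply/subsetP => _ /imsetP[U + ->].
by rewrite !inE => /andP[SU /eqP <-]; rewrite cardsDS.
Qed.

Lemma card_pairs (S T : finType) (P : pred S) (Q : S -> pred T) :
  #|[set u : S * T | P u.1 & Q u.1 u.2]| = (\sum_(x | P x) #|[set y | Q x y]|)%N.
Proof.
rewrite -sum1dep_card.
under [RHS]eq_bigr do rewrite -sum1dep_card.
by rewrite pair_big_dep.
Qed.

(** The list [Cf] holds colours that are reserved for another part of the
    factor. *)
Definition color_bad r (V : finType) (G : hypergraph r V) (C : eqType)
    (col : {set V} -> C) (Cf : seq C) (U : {set V}) : bool :=
  [exists e in edges G, (e \subset U) && ((col e \in Cf) ||
     [exists e' in edges G, [&& e' \subset U, e' != e & col e' == col e]])].

Definition color_clash r (V : finType) (G : hypergraph r V) (C : eqType)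
    (col : {set V} -> C) (U U' : {set V}) : bool :=
  [exists e in edges G, [exists e' in edges G,
     [&& e \subset U, e' \subset U' & col e == col e']]].

Lemma color_clash_sym r V G C col : symmetric (@color_clash r V G C col).
Proof.
move=> U U'; apply/exists_inP/exists_inP => -[e eG /exists_inP[e' e'G /and3P[h1 h2 /eqP h3]]];
  by exists e' => //; apply/exists_inP; exists e => //; rewrite h1 h2 h3 eqxx.
Qed.

(** If [U] is colour-bad then some point [x != v] of [U] completes an
    [(r - 1)]-subset of [U :\ x] to an edge whose colour is already forced by
    [Cf] and by the edges inside [U :\ x].  For each [U :\ x] there are boundedly
    many such subsets and colours, and the local half of [mu_bounded] leaves only
    [mu * #|V|] candidates for [x] in each case. *)
Lemma card_color_bad (R : realType) (mu : R) r m (V : finType)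
    (G : hypergraph r V) (C : eqType) (col : {set V} -> C) (Cf : seq C) v :
  (1 < r)%N -> (0 < m)%N -> 0 <= mu -> mu_bounded mu G col ->
  #|[set U : {set V} | [&& #|U| == m.+1, v \in U & color_bad G col Cf U]]|%:R
    <= (2 ^ m * (size Cf + 2 ^ m))%:R * mu * #|V|%:R ^+ m.
Proof.
move=> r1 m0 mu0 bd.
pose L (A : {set V}) := Cf ++ [seq col e | e <- enum (powerset A)].
pose Z (A : {set V}) := [set x | [exists I : {set V},
   [&& I \subset A, #|I| == (r - 1)%N, x |: I \in edges G & col (x |: I) \in L A]]].
have sub : [set U : {set V} | [&& #|U| == m.+1, v \in U & color_bad G col Cf U]]
   \subset \bigcup_(A : {set V} | ([set v] \subset A) && (#|A| == m))
     [set x |: A | x in Z A].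
  apply/subsetP => U; rewrite inE => /and3P[/eqP Um vU bU].
  suff [x [e [xv xe eG eU ce]]] : exists x (e : {set V}),
      [/\ x != v, x \in e, e \in edges G, e \subset U & col e \in L (U :\ x)].
    have xU := subsetP eU _ xe.
    apply/bigcupP; exists (U :\ x).
      rewrite sub1set !inE eq_sym xv vU /=.
      by move: Um; rewrite (cardsD1 x) xU add1n => -[->].
    apply/imsetP; exists x; last by rewrite setD1K.
    rewrite inE; apply/existsP; exists (e :\ x); rewrite setD1K // eG ce !andbT.
    rewrite setSD //=; have := edges_uniform eG.
    by rewrite (cardsD1 x) xe => <-; rewrite add1n subn1.
  have lmem (x : V) (e : {set V}) : e \subset U -> x \notin e -> col e \in L (U :\ x).
    move=> eU xe; rewrite mem_cat; apply/orP; right; apply: map_f.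
    by rewrite mem_enum powersetE subsetD1 eU xe.
  case/exists_inP: bU => e eG /andP[eU /orP[ce|/exists_inP[e' e'G /and3P[e'U ee' /eqP ce]]]].
    have : (0 < #|e :\ v|)%N.
      by have := edges_uniform eG; rewrite (cardsD1 v); lia.
    case/card_gt0P => x; rewrite !inE => /andP[xv xe].
    by exists x, e; split=> //; rewrite mem_cat ce.
  have dif (e1 e2 : {set V}) : e1 \in edges G -> e2 \in edges G -> e1 != e2 ->
      exists2 y, y \in e1 & y \notin e2.
    move=> h1 h2 ne; have : (0 < #|e1 :\: e2|)%N.
      rewrite card_gt0 setD_eq0; apply: contra ne => s.
      by rewrite eqEcard s (edges_uniform h1) (edges_uniform h2) leqnn.
    by case/card_gt0P => y; rewrite inE => /andP[? ?]; exists y.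
  (* both differences of two edges are nonempty, so one of them contains a
     point other than [v] *)
  have [|y ye ye'] := dif _ _ eG e'G; first by rewrite eq_sym.
  have [y' y'e' y'e] := dif _ _ e'G eG ee'.
  have [yv|yv] := eqVneq y v; last by exists y, e; split=> //; rewrite -ce lmem.
  exists y', e'; split=> //; last by rewrite ce lmem.
  by apply: contraNneq y'e => ->; rewrite -yv.
have Zle (A : {set V}) : #|A| = m -> #|Z A|%:R <= (2 ^ m * (size Cf + 2 ^ m))%:R * mu * #|V|%:R.
  move=> Am.
  have szL : size (L A) = (size Cf + 2 ^ m)%N.
    by rewrite size_cat size_map -cardE card_powerset Am.
  pose ZI (I : {set V}) (c : C) := [set x | (x |: I \in edges G) && (col (x |: I) == c)].
  pose P (I : {set V}) := (I \subset A) && (#|I| == (r - 1)%N).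
  have Zsub : Z A \subset \bigcup_(I | P I) \bigcup_(i < size (L A))
      ZI I (tnth (in_tuple (L A)) i).
    apply/subsetP => x; rewrite inE => /existsP[I /and4P[IA Ir xG xc]].
    apply/bigcupP; exists I; first by rewrite /P IA Ir.
    have /tnthP[i ei] : col (x |: I) \in in_tuple (L A) by [].
    by apply/bigcupP; exists i => //; rewrite inE xG ei eqxx.
  have ZIle I c : P I -> #|ZI I c|%:R <= mu * #|V|%:R.
    case/andP=> _ /eqP Ir; apply: le_trans (proj2 (bd c) I Ir); rewrite ler_nat.
    rewrite -(@card_in_imset _ _ (fun x => x |: I)); last first.
      have xI y : y |: I \in edges G -> y \notin I.
        move/edges_uniform; rewrite cardsU1 Ir; case: (y \in I) => //=.
        by rewrite add0n; lia.
      move=> x y; rewrite !inE => /andP[/xI xn _] /andP[/xI yn _] e.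
      have : x \in y |: I by rewrite -e setU11.
      by rewrite !inE (negPf xn) orbF => /eqP.
    apply: subset_leq_card; apply/subsetP => _ /imsetP[x + ->].
    by rewrite !inE => /andP[-> ->]; rewrite subsetUr.
  apply: (@le_trans _ _ (\sum_(I | P I) \sum_(i < size (L A)) mu * #|V|%:R)).
    apply: (@le_trans _ _ (\sum_(I | P I) \sum_(i < size (L A))
               #|ZI I (tnth (in_tuple (L A)) i)|)%:R).
      rewrite ler_nat; apply: (leq_trans (subset_leq_card Zsub)).
      apply: (leq_trans (card_bigcup_le _ _)).
      by apply: leq_sum => I _; exact: card_bigcup_le.
    rewrite natr_sum; apply: ler_sum => I PI; rewrite natr_sum.
    by apply: ler_sum => i _; exact: ZIle.
  under eq_bigr do rewrite sumr_const card_ord szL.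
  rewrite sumr_const -mulrnA -[leLHS]mulr_natl -[leRHS]mulrA ler_wpM2r ?mulr_ge0 //.
  rewrite ler_nat mulnC leq_mul2r; apply/orP; right.
  rewrite -Am -card_powerset; apply: subset_leq_card; apply/subsetP => I.
  by rewrite inE => /andP[].
apply: (@le_trans _ _ (\sum_(A : {set V} | ([set v] \subset A) && (#|A| == m)) #|Z A|)%:R).
  rewrite ler_nat; apply: (leq_trans (subset_leq_card sub)).
  apply: (leq_trans (card_bigcup_le _ _)).
  by apply: leq_sum => A _; exact: leq_imset_card.
rewrite natr_sum.
apply: (@le_trans _ _ (\sum_(A : {set V} | ([set v] \subset A) && (#|A| == m))
          (2 ^ m * (size Cf + 2 ^ m))%:R * mu * #|V|%:R)).
  by apply: ler_sum => A /andP[_ /eqP]; exact: Zle.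
rewrite sumr_const -[leLHS]mulr_natr.
have -> : #|V|%:R ^+ m = #|V|%:R * #|V|%:R ^+ m.-1 :> R by rewrite -exprS prednK.
rewrite mulrA ler_wpM2l ?mulr_ge0 // -natrX ler_nat.
have := card_supersets [set v] m; rewrite cards1 subn1.
by apply: leq_trans; rewrite leq_eqVlt; apply/orP; left; apply/eqP/eq_card => A; rewrite !inE.
Qed.

(** Here the two edges of equal colour lie in disjoint blocks, and the global
    half of [mu_bounded] is what counts: given the edge in the first block, there
    are only [mu * #|V| ^ (r - 1)] edges for the second block to contain. *)
Lemma card_color_clash (R : realType) (mu : R) r m (V : finType)
    (G : hypergraph r V) (C : eqType) (col : {set V} -> C) v :
  (r <= m.+1)%N -> (0 < r)%N -> 0 <= mu -> mu_bounded mu G col ->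
  #|[set u : {set V} * {set V} |
      [&& #|u.1| == m.+1, #|u.2| == m.+1, v \in u.1, [disjoint u.1 & u.2]
        & color_clash G col u.1 u.2]]|%:R
    <= ('C(#|V|.-1, m) * 2 ^ m.+1)%:R * mu * #|V|%:R ^+ m.
Proof.
move=> rm r0 mu0 bd.
pose P (U : {set V}) := [&& v \in U, #|U| == m.+1 & [disjoint U & set0]].
pose Q (U U' : {set V}) := (#|U'| == m.+1) && color_clash G col U U'.
have sub : [set u : {set V} * {set V} |
      [&& #|u.1| == m.+1, #|u.2| == m.+1, v \in u.1, [disjoint u.1 & u.2]
        & color_clash G col u.1 u.2]] \subset [set u | P u.1 & Q u.1 u.2].
  apply/subsetP => -[U U']; rewrite !inE /= /P /Q => /and5P[-> -> -> _ ->].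
  by rewrite -setI_eq0 setI0 eqxx.
apply: (@le_trans _ _ (\sum_(U | P U) #|[set U' | Q U U']|)%:R).
  by rewrite -card_pairs ler_nat subset_leq_card.
rewrite natr_sum.
apply: (@le_trans _ _ (\sum_(U | P U) (2 ^ m.+1)%:R * mu * #|V|%:R ^+ m)); last first.
  rewrite sumr_const -[leLHS]mulr_natl natrM -!mulrA.
  suff -> : 'C(#|V|.-1, m) = #|P| by [].
  have := @card_pointed_sets m V set0 v; rewrite inE cards0 subn1 => <- //.
  by apply: eq_card => U; rewrite inE.
apply: ler_sum => U /and3P[_ /eqP Um _].
pose E c := [set e in edges G | col e == c].
have Qsub : [set U' | Q U U'] \subset \bigcup_(e in powerset U) \bigcup_(e' in E (col e))
    [set U' : {set V} | e' \subset U' & #|U'| == m.+1].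
  apply/subsetP => U'; rewrite inE => /andP[U'm /exists_inP[e eG]].
  case/exists_inP => e' e'G /and3P[eU e'U' /eqP ce].
  apply/bigcupP; exists e; first by rewrite powersetE.
  by apply/bigcupP; exists e'; rewrite !inE ?e'G ?ce ?eqxx ?e'U'.
apply: (@le_trans _ _ (\sum_(e in powerset U) \sum_(e' in E (col e)) #|V| ^ (m.+1 - r))%:R).
  rewrite ler_nat; apply: (leq_trans (subset_leq_card Qsub)).
  apply: (leq_trans (card_bigcup_le _ _)); apply: leq_sum => e _.
  apply: (leq_trans (card_bigcup_le _ _)); apply: leq_sum => e'.
  rewrite inE => /andP[/edges_uniform <- _]; exact: card_supersets.
rewrite natr_sum.
apply: (@le_trans _ _ (\sum_(e in powerset U) mu * #|V|%:R ^+ m)).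
  apply: ler_sum => e _; rewrite sum_nat_const natrM natrX.
  have -> : m = ((r - 1) + (m.+1 - r))%N by lia.
  rewrite exprD mulrA (_ : (r - 1 + (m.+1 - r)).+1 = m.+1); last by lia.
  by rewrite ler_wpM2r ?exprn_ge0 //; have [] := bd (col e).
by rewrite sumr_const -[leLHS]mulr_natl card_powerset Um mulrA.
Qed.

(** * A Chernoff bound for disjoint blocks of coordinates *)

Definition override (X V : finType) q (b : 'I_q -> X) (f : {ffun X -> V})
    (y : {ffun 'I_q -> V}) : {ffun X -> V} :=
  [ffun x => if [pick i | b i == x] is Some i then y i else f x].

Lemma override_in (X V : finType) q (b : 'I_q -> X) (f : {ffun X -> V}) y i :
  injective b -> override b f y (b i) = y i.
Proof.
move=> bi; rewrite ffunE; case: pickP => [j /eqP /bi -> //|/(_ i)].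
by rewrite eqxx.
Qed.

Lemma override_out (X V : finType) q (b : 'I_q -> X) (f : {ffun X -> V}) y x :
  (forall i, b i != x) -> override b f y x = f x.
Proof.
move=> bx; rewrite ffunE; case: pickP => // j; by rewrite (negPf (bx j)).
Qed.

Definition restrict (X V : finType) q (b : 'I_q -> X) (f : {ffun X -> V}) :=
  [ffun i => f (b i)].

(** Independence of the coordinates [b] of a uniform [f] from all the others: the
    involution that exchanges these coordinates with an independent tuple [y]
    turns [w f (restrict b f)] into [w f y] and fixes what does not depend on
    them. *)
Lemma sum_resample (R : realFieldType) (X V : finType) q (b : 'I_q -> X)
    (g : {ffun X -> V} -> R) (w : {ffun X -> V} -> {ffun 'I_q -> V} -> R) :
  injective b -> (forall f y, g (override b f y) = g f) ->
  (forall f y, w (override b f y) = w f) ->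
  (\sum_f g f * w f (restrict b f)) * (#|V| ^ q)%:R = \sum_f g f * \sum_y w f y.
Proof.
move=> bi gi wi.
pose phi (u : {ffun X -> V} * {ffun 'I_q -> V}) := (override b u.1 u.2, restrict b u.1).
have phiK : involutive phi.
  move=> [f y]; congr pair; apply/ffunP => x /=; last by rewrite ffunE override_in.
  rewrite ffunE /=; case: pickP => [i /eqP <-|h]; first by rewrite ffunE.
  by rewrite override_out // => i; rewrite h.
transitivity (\sum_(u : {ffun X -> V} * {ffun 'I_q -> V}) g u.1 * w u.1 u.2); last first.
  rewrite -(pair_big predT predT (fun f y => g f * w f y)) /=.
  by apply: eq_bigr => f _; rewrite mulr_sumr.
rewrite (reindex_inj (inv_inj phiK)) /=.
rewrite -(pair_big predT predT (fun f y =>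
  g (override b f y) * w (override b f y) (restrict b f))) /=.
rewrite mulr_suml; apply: eq_bigr => f _.
under eq_bigr do rewrite gi wi.
by rewrite sumr_const card_ffun card_ord mulr_natr.
Qed.

(** A second-order upper bound; it follows from [1 <= (1 + x) * (1 - x + x ^+ 2)]. *)
Lemma expRN_le (R : realType) (x : R) : 0 <= x -> expR (- x) <= 1 - x + x ^+ 2.
Proof.
move=> x0; have h := expR_ge1Dx x; have h0 := expR_gt0 (- x).
have h1 := expRxMexpNx_1 x.
have : expR (- x) * (1 + x) <= 1.
  by apply: le_trans (_ : expR (- x) * expR x <= 1);
    [exact: ler_wpM2l (ltW h0) _ _ h | rewrite mulrC h1].
move=> h2; rewrite -subr_ge0 -(pmulr_lge0 _ (_ : 0 < 1 + x)); last by lra.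
have : 0 <= x ^+ 3 by exact: exprn_ge0.
by rewrite !exprS expr0 !mulr1; nra.
Qed.

Lemma sum_blocks (R : realFieldType) (X V : finType) q (I : eqType) (b : I -> 'I_q -> X)
    (g : {ffun X -> V} -> R) (w : {ffun X -> V} -> {ffun 'I_q -> V} -> R) (B : R)
    (s : seq I) :
  (0 < #|V|)%N -> uniq s -> (forall a a' i i', b a i = b a' i' -> a = a' /\ i = i') ->
  (forall f, 0 <= g f) -> (forall f y, 0 <= w f y) -> 0 <= B ->
  (forall a f y, g (override (b a) f y) = g f) ->
  (forall a f y, w (override (b a) f y) = w f) ->
  (forall f, g f != 0 -> \sum_y w f y <= B * (#|V| ^ q)%:R) ->
  \sum_f g f * \prod_(a <- s) w f (restrict (b a) f)
    <= B ^+ size s * \sum_f g f.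
Proof.
move=> V0 + binj g0 w0 B0 gi wi wB.
elim: s => [|a s IH] /=.
  by rewrite expr0 mul1r; under eq_bigr do rewrite big_nil mulr1.
case/andP=> as_ us.
have nq0 : 0 < (#|V| ^ q)%:R :> R by rewrite ltr0n expn_gt0 V0.
have bai : injective (b a) by move=> i i' /binj[].
pose g' f := g f * \prod_(c <- s) w f (restrict (b c) f).
have g'i f y : g' (override (b a) f y) = g' f.
  rewrite /g' gi; congr (_ * _); apply: eq_big_seq => c cs; rewrite wi.
  congr (w f _); apply/ffunP => i; rewrite !ffunE; case: pickP => // j /eqP /binj[ac _].
  by rewrite ac cs in as_.
rewrite -(ler_pM2r nq0).
under eq_bigr do rewrite big_cons mulrCA mulrC -/(g' _).
rewrite (sum_resample bai g'i (wi a)).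
apply: (@le_trans _ _ (\sum_f g' f * (B * (#|V| ^ q)%:R))).
  apply: ler_sum => f _; have [gf|gf] := eqVneq (g f) 0.
    by rewrite /g' gf !mul0r.
  by rewrite ler_wpM2l ?wB // mulr_ge0 // prodr_ge0.
rewrite -mulr_suml exprS [leRHS](_ : _ =
  (B ^+ size s * \sum_f g f) * (B * (#|V| ^ q)%:R)); last by ring.
by apply: ler_wpM2r; [exact: mulr_ge0 (ltW nq0) | exact: IH].
Qed.

(** A Chernoff bound: if each block of coordinates falls in [A f] with probability
    at least [p], then the number of blocks that do so is rarely below
    [(p - eta) * M].  The weight [g] selects the [f] of interest and may, like
    [A], depend on [f] outside the blocks; this is how the bound is used
    conditionally on some coordinates. *)
Lemma sum_low_blocks (R : realType) (X V : finType) q M (b : 'I_M -> 'I_q -> X)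
    (g : {ffun X -> V} -> R) (A : {ffun X -> V} -> {set {ffun 'I_q -> V}})
    (p eta : R) :
  (0 < #|V|)%N -> (forall a a' i i', b a i = b a' i' -> a = a' /\ i = i') ->
  (forall f, 0 <= g f) -> (forall a f y, g (override (b a) f y) = g f) ->
  (forall a f y, A (override (b a) f y) = A f) -> 0 <= eta ->
  (forall f, g f != 0 -> p * (#|V| ^ q)%:R <= #|A f|%:R) -> eta <= p ->
  p <= 1 ->
  \sum_(f | #|[set a | restrict (b a) f \in A f]|%:R < (p - eta) * M%:R) g f
    <= expR (- (eta ^+ 2 / 4 * M%:R)) * \sum_f g f.
Proof.
move=> V0 binj g0 gi Ai eta0 pA etap p1.
(* [x] minimizes the exponent [x ^+ 2 - x * eta] that results for [p <= 1] *)
pose x := eta / 2; pose z := expR (- x).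
pose w (f : {ffun X -> V}) y : R := if y \in A f then z else 1.
have z0 : 0 < z by exact: expR_gt0.
have x0 : 0 <= x by rewrite /x; lra.
have z1 : z <= 1 by rewrite expR_le1 oppr_le0.
have zub : z <= 1 - x + x ^+ 2 by exact: expRN_le.
have B0 : 0 <= 1 - (1 - z) * p by nra.
have w0 f y : 0 <= w f y by rewrite /w; case: ifP => _ //; exact: ltW.
have wi a f y : w (override (b a) f y) = w f by rewrite /w Ai.
have wB f : g f != 0 -> \sum_y w f y <= (1 - (1 - z) * p) * (#|V| ^ q)%:R.
  move=> /pA hA.
  rewrite (bigID (mem (A f))) /= /w.
  under eq_bigr => y yA do rewrite yA.
  rewrite sumr_const; under eq_bigr => y /negPf yA do rewrite yA.
  rewrite sumr_const.
  have := cardC (mem (A f)); rewrite card_ffun card_ord => e.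
  have {}e : #|A f|%:R + #|[predC mem (A f)]|%:R = (#|V| ^ q)%:R :> R by rewrite -natrD e.
  have -> : #|(fun y => y \notin A f)| = #|[predC mem (A f)]| by apply: eq_card.
  rewrite -(mulr_natl z); move: hA e.
  move: (#|A f|%:R) (#|[predC mem (A f)]|%:R) ((#|V| ^ q)%:R) => k k' N hA e.
  by nra.
have := @sum_blocks R X V q _ b g w (1 - (1 - z) * p) (enum 'I_M) V0
  (enum_uniq _) binj g0 w0 B0 gi wi wB.
rewrite size_enum_ord; under eq_bigr do rewrite big_enum; move=> ub.
pose low := [pred f : {ffun X -> V} |
  #|[set a | restrict (b a) f \in A f]|%:R < (p - eta) * M%:R].
have wlow f : low f -> expR (- (x * (p - eta) * M%:R)) <= \prod_a w f (restrict (b a) f).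
  move=> lf; rewrite (bigID (fun a => restrict (b a) f \in A f)) /= /w.
  rewrite [X in _ <= _ * X]big1; last by move=> a /negPf->.
  rewrite (eq_bigr (fun=> z)); last by move=> a ->.
  rewrite mulr1 prodr_const -expRM_natl ler_expR.
  rewrite mulrN lerN2 -mulrA [leLHS]mulrC; apply: ler_wpM2l => //; apply: ltW.
  by move: lf; rewrite /low /= cardsE.
have gs0 : 0 <= \sum_f g f by apply: sumr_ge0.
have h1 : (\sum_(f | low f) g f) * expR (- (x * (p - eta) * M%:R))
    <= (1 - (1 - z) * p) ^+ M * \sum_f g f.
  apply: le_trans ub; rewrite mulr_suml [leRHS](bigID low) /=.
  rewrite -[leLHS]addr0; apply: lerD.
    by apply: ler_sum => f /wlow; apply: ler_wpM2l.
  by apply: sumr_ge0 => f _; rewrite mulr_ge0 // prodr_ge0.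
have h2 : (1 - (1 - z) * p) ^+ M <= expR (M%:R * - ((1 - z) * p)).
  rewrite expRM_natl lerXn2r ?nnegrE //; first exact: expR_ge0.
  exact: expR_ge1Dx.
have h3 : (\sum_(f | low f) g f) <=
   expR (M%:R * - ((1 - z) * p) + x * (p - eta) * M%:R) * \sum_f g f.
  rewrite expRD mulrAC -ler_pdivrMr ?expR_gt0 // -expRN.
  by apply: le_trans h1 _; exact: ler_wpM2r.
apply: le_trans h3 _; apply: ler_wpM2r => //; rewrite ler_expR.
have M0 : 0 <= M%:R :> R by [].
have key : x * (p - eta) - (1 - z) * p <= - (eta ^+ 2 / 4).
  have -> : eta ^+ 2 / 4 = x ^+ 2 by rewrite /x; field.
  by have : eta = 2 * x by [rewrite /x; field]; nra.
have -> : M%:R * - ((1 - z) * p) + x * (p - eta) * M%:R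
  = (x * (p - eta) - (1 - z) * p) * M%:R by ring.
by have := ler_wpM2r M0 key; lra.
Qed.

(** * Degrees inside a random block *)

Lemma card_tuples_onto (V : finType) q (S e : {set V}) :
  S \subset e -> #|e| = (#|S| + q)%N ->
  #|[set y : {ffun 'I_q -> V} | S :|: y @: [set: 'I_q] == e]| = q`!.
Proof.
move=> Se eq_.
have eS : #|e :\: S| = q by rewrite cardsDS // eq_ addKn.
have <- : #|[set y : {ffun 'I_q -> V} in ffun_on (mem (e :\: S)) | injectiveb y]| = q`!.
  by rewrite card_inj_ffuns_on card_ord -ffactnn; congr (_ ^_ _); rewrite -[RHS]eS; exact: eq_card.
apply: eq_card => y; rewrite !inE.
apply/eqP/andP => [Sy|[/ffun_onP yon /injectiveP yi]].
  have sub : e :\: S \subset y @: [set: 'I_q].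
    by rewrite -Sy setDUl setDv finset.set0U subsetDl.
  have cy : (#|y @: [set: 'I_q]| <= q)%N.
    by rewrite (leq_trans (leq_imset_card _ _)) // cardsT card_ord.
  have ye : e :\: S = y @: [set: 'I_q].
    by apply/eqP; rewrite eqEcard sub eS.
  split; first by apply/ffun_onP => i; rewrite ye imset_f.
  have /imset_injP yi : #|y @: [set: 'I_q]| == #|[set: 'I_q]|.
    by rewrite -ye eS cardsT card_ord.
  by apply/injectiveP => i i'; apply: yi; rewrite inE.
have ye : y @: [set: 'I_q] = e :\: S.
  apply/eqP; rewrite eqEcard card_imset // eS cardsT card_ord leqnn andbT.
  by apply/subsetP => _ /imsetP[i _ ->].
by rewrite ye -{1}(setIidPr Se) setID.
Qed.

Lemma card_tuples_in (V : finType) q (S : {set V}) (D : {set {set V}}) :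
  {in D, forall e : {set V}, S \subset e /\ #|e| = (#|S| + q)%N} ->
  #|[set y : {ffun 'I_q -> V} | S :|: y @: [set: 'I_q] \in D]| = (#|D| * q`!)%N.
Proof.
move=> hD; rewrite -sum1dep_card.
rewrite (partition_big (fun y : {ffun 'I_q -> V} => S :|: y @: [set: 'I_q]) (mem D)) //=.
rewrite -sum_nat_const; apply: eq_bigr => e eD.
have [Se eq_] := hD _ eD.
rewrite -(card_tuples_onto Se eq_) -sum1dep_card; apply: eq_bigl => y.
by case: eqP => [->|]; rewrite ?andbF ?eD.
Qed.

Definition link_tuples r (X V : finType) (G : hypergraph r V) (L : {set X}) q
    (f : {ffun X -> V}) : {set {ffun 'I_q -> V}} :=
  [set y : {ffun 'I_q -> V} | f @: L :|: y @: [set: 'I_q] \in edges G].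

Definition induced_degree r (V : finType) (G : hypergraph r V) (U L : {set V}) :=
  #|[set e in edges G | (L \subset e) && (e \subset U)]|.

Lemma card_link_tuples r (X V : finType) (G : hypergraph r V) (L : {set X}) q
    (f : {ffun X -> V}) : r = (#|f @: L| + q)%N ->
  #|link_tuples G L q f| = (degree G (f @: L) * q`!)%N.
Proof.
move=> rq; rewrite /degree -(@card_tuples_in V q (f @: L)).
  by apply: eq_card => y; rewrite !inE subsetUl andbT.
by move=> e; rewrite inE => /andP[eG Se]; rewrite Se (edges_uniform eG).
Qed.

(** Coordinates are arranged in [t] classes, each a copy of the cyclic group
    of order [M.+1].  For [tau] injective, the tuples
    [shifted_block iota tau s a] with [a] varying are pairwise disjoint, so that
    a Chernoff bound applies to them; as [s] varies too, every choice of one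
    coordinate in each of the classes [tau i] is met equally often.  This uses
    only polynomially many families in the block size, so a union bound over
    the families is affordable, and for large [t] nearly all [q]-sets of
    coordinates meet each class at most once. *)
Definition shifted_block (X : finType) t M q (iota : 'I_t * 'I_M.+1 -> X)
    (tau : {ffun 'I_q -> 'I_t}) (s : {ffun 'I_q -> 'I_M.+1}) (a : 'I_M.+1) : 'I_q -> X :=
  fun i => iota (tau i, s i + a).

(** Double counting: each admissible tuple of coordinates is met by [M.+1] pairs
    [(s, a)], and each edge arises from [q`!] ordered tuples. *)
Lemma dense_of_shifts (R : realFieldType) r (X V : finType) (G : hypergraph r V)
    (L : {set X}) q (f : {ffun X -> V}) t M (iota : 'I_t * 'I_M.+1 -> X) (c : R) :
  injective f -> injective iota -> r = (#|L| + q)%N ->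
  (forall (tau : {ffun 'I_q -> 'I_t}) s, injective tau -> c * M.+1%:R <=
     #|[set a | restrict (shifted_block iota tau s a) f \in link_tuples G L q f]|%:R) ->
  c * (t ^_ q * M.+1 ^ q)%:R <= (q`! * induced_degree G (f @: [set: X]) (f @: L))%:R.
Proof.
move=> fi ii rq hc.
have block0 (tau : {ffun 'I_q -> 'I_t}) s i : shifted_block iota tau s 0 i = iota (tau i, s i).
  by rewrite /shifted_block addr0.
pose sel (u : {ffun 'I_q -> 'I_t} * {ffun 'I_q -> 'I_M.+1}) :=
  restrict (shifted_block iota u.1 u.2 0) f.
pose good := [set u : {ffun 'I_q -> 'I_t} * {ffun 'I_q -> 'I_M.+1} |
  injectiveb u.1 & sel u \in link_tuples G L q f].
pose D := [set e in edges G | (f @: L \subset e) && (e \subset f @: [set: X])].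
have up : (#|good| <= q`! * #|D|)%N.
  rewrite mulnC -(@card_tuples_in _ q (f @: L)); last first.
    move=> e; rewrite inE => /and3P[eG Se _].
    by rewrite Se (edges_uniform eG) rq card_imset.
  have seli : injective sel.
    move=> [u1 u2] [w1 w2] /ffunP e.
    have {}e i : u1 i = w1 i /\ u2 i = w2 i.
      by move: (e i); rewrite !ffunE !block0 => /fi /ii [].
    by congr pair; apply/ffunP => i; have [] := e i.
  rewrite -(card_imset _ seli); apply: subset_leq_card.
  apply/subsetP => _ /imsetP[u + ->]; rewrite !inE => /andP[_ ->].
  rewrite subsetUl /= subUset imsetS ?finset.subsetT //=.
  apply/subsetP => _ /imsetP[i _ ->]; rewrite ffunE; exact: imset_f.
have low : c * (t ^_ q * M.+1 ^ q)%:R * M.+1%:R <= (#|good| * M.+1)%:R.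
  have -> : (#|good| * M.+1)%N = (\sum_(tau : {ffun 'I_q -> 'I_t} | injectiveb tau)
     \sum_(s : {ffun 'I_q -> 'I_M.+1})
     #|[set a | restrict (shifted_block iota tau s a) f \in link_tuples G L q f]|)%N.
    transitivity (\sum_(tau : {ffun 'I_q -> 'I_t} | injectiveb tau)
      \sum_(a : 'I_M.+1) #|[set s | sel (tau, s) \in link_tuples G L q f]|)%N.
      under [RHS]eq_bigr do rewrite sum_nat_const card_ord mulnC.
      rewrite -big_distrl /=; congr (_ * _)%N.
      rewrite -[RHS](@card_pairs _ _ (fun tau : {ffun 'I_q -> 'I_t} => injectiveb tau)
        (fun tau s => sel (tau, s) \in link_tuples G L q f)).
      by apply: eq_card => -[u1 u2]; rewrite !inE.
    apply: eq_bigr => tau _.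
    under eq_bigr do rewrite -sum1dep_card.
    under [RHS]eq_bigr do rewrite -sum1dep_card.
    rewrite [RHS](exchange_big_dep predT) //=; apply: eq_bigr => a _.
    pose shift (s : {ffun 'I_q -> 'I_M.+1}) : {ffun 'I_q -> 'I_M.+1} := [ffun i => s i + a].
    have shi : injective shift.
      move=> s1 s2 /ffunP e; apply/ffunP => i.
      by have := e i; rewrite !ffunE => /addIr.
    rewrite (reindex_inj shi) /=; apply: eq_bigl => s.
    suff -> : sel (tau, shift s) = restrict (shifted_block iota tau s a) f by [].
    by apply/ffunP => i; rewrite !ffunE block0 ffunE.
  rewrite natr_sum.
  apply: (@le_trans _ _ (\sum_(tau : {ffun 'I_q -> 'I_t} | injectiveb tau)
     \sum_(s : {ffun 'I_q -> 'I_M.+1}) c * M.+1%:R)).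
    under eq_bigr do rewrite sumr_const card_ffun !card_ord.
    rewrite sumr_const -mulrnA -[leRHS]mulr_natr.
    rewrite [leLHS](_ : _ = c * M.+1%:R * (M.+1 ^ q * t ^_ q)%:R).
      suff -> : #|[pred tau : {ffun 'I_q -> 'I_t} | injectiveb tau]| = t ^_ q by [].
      have := card_inj_ffuns 'I_q 'I_t; rewrite !card_ord => <-.
      by apply: eq_card => tau; rewrite !inE.
    by rewrite !natrM; ring.
  apply: ler_sum => tau /injectiveP ti; rewrite natr_sum; apply: ler_sum => s _.
  exact: hc.
rewrite -(ler_pM2r (_ : 0 < M.+1%:R)) ?ltr0n //; apply: le_trans low _.
by rewrite -natrM ler_nat leq_mul2r /= up.
Qed.

Lemma sum_ffun_at (R : realFieldType) (X V : finType) (j : X) (v : V) :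
  (0 < #|V|)%N ->
  \sum_(f : {ffun X -> V}) ((f j == v)%:R : R) = (#|V| ^ #|X|.-1)%:R.
Proof.
move=> V0.
have b1i : injective (fun _ : 'I_1 => j) by move=> ? ? _; rewrite !ord1.
have := @sum_resample R X V 1 (fun=> j) (fun=> 1) (fun _ y => (y ord0 == v)%:R) b1i
  (fun _ _ => erefl) (fun _ _ => erefl).
move/eqP; rewrite expn1.
under eq_bigr do rewrite mul1r ffunE.
have -> : \sum_(y : {ffun 'I_1 -> V}) ((y ord0 == v)%:R : R) = 1.
  rewrite (bigD1 [ffun=> v]) //= ffunE eqxx big1 ?addr0 // => y yv.
  by case: eqP => // e; case/negP: yv; apply/eqP/ffunP => i; rewrite ord1 e ffunE.
have e : (#|V| ^ #|X| = #|V| ^ #|X|.-1 * #|V|)%N.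
  by rewrite -expnSr prednK //; apply/card_gt0P; exists j.
by rewrite mul1r sumr_const card_ffun e natrM => /eqP; apply: mulIf; rewrite pnatr_eq0 -lt0n.
Qed.

(** Conditionally on [f j = v] and on the restriction of [f] to [L], a low degree
    of the image of [L] forces one of the families of shifted blocks to be low,
    and there are at most [t ^ q * M.+1 ^ q] of them. *)
Lemma sum_low_induced_degree (R : realType) r (X V : finType) (G : hypergraph r V)
    (L : {set X}) q (j : X) (v : V) t M (iota : 'I_t * 'I_M.+1 -> X) (p eta : R) :
  (0 < #|V|)%N -> injective iota -> (forall u, iota u \notin j |: L) ->
  r = (#|L| + q)%N -> 0 <= eta -> eta <= p -> p <= 1 ->
  (forall S : {set V}, #|S| = #|L| -> p * (#|V| ^ q)%:R <= (degree G S * q`!)%:R) ->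
  #|[set f : {ffun X -> V} | [&& injectiveb f, f j == v &
      (q`! * induced_degree G (f @: [set: X]) (f @: L))%:R
        < (p - eta) * (t ^_ q * M.+1 ^ q)%:R]]|%:R
    <= (t ^ q * M.+1 ^ q)%:R * expR (- (eta ^+ 2 / 4 * M.+1%:R)) * (#|V| ^ #|X|.-1)%:R.
Proof.
move=> V0 ii iL rq eta0 etap p1 degG.
pose T := ({ffun 'I_q -> 'I_t} * {ffun 'I_q -> 'I_M.+1})%type.
pose A := @link_tuples r X V G L q.
pose low (u : T) (f : {ffun X -> V}) :=
  #|[set a | restrict (shifted_block iota u.1 u.2 a) f \in A f]|%:R < (p - eta) * M.+1%:R.
pose g (f : {ffun X -> V}) : R := (f j == v)%:R * (#|f @: L| == #|L|)%:R.
have g0 f : 0 <= g f by rewrite mulr_ge0.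
have ov (u : T) (x : X) a (f : {ffun X -> V}) y : x \in j |: L ->
    override (shifted_block iota u.1 u.2 a) f y x = f x.
  move=> xL; apply: override_out => i; apply: contraTneq xL => <-; exact: iL.
have imL (u : T) a (f : {ffun X -> V}) y :
    override (shifted_block iota u.1 u.2 a) f y @: L = f @: L.
  by apply: eq_in_imset => x xL; rewrite (ov u) // !inE xL orbT.
have key (u : T) : injective u.1 -> \sum_(f | low u f) g f <=
    expR (- (eta ^+ 2 / 4 * M.+1%:R)) * (#|V| ^ #|X|.-1)%:R.
  move=> ui.
  apply: le_trans (@sum_low_blocks R X V q M.+1 (shifted_block iota u.1 u.2) g A p eta
    V0 _ g0 _ _ eta0 _ etap p1) _.
  - move=> a a' i i' /ii e; have /ui ii' : u.1 i = u.1 i' := congr1 fst e.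
    have : u.2 i + a = u.2 i' + a' := congr1 snd e.
    by rewrite ii' => /addrI.
  - by move=> a f y; rewrite /g imL (ov u) // setU11.
  - by move=> a f y; rewrite /A /link_tuples imL.
  - move=> f gf; have fL : #|f @: L| = #|L|.
      by apply/eqP; apply: contraNT gf => /negPf h; rewrite /g h mulr0.
    rewrite /A card_link_tuples ?fL //; exact: degG.
  apply: ler_wpM2l; first exact: expR_ge0.
  rewrite -(sum_ffun_at R j v V0); apply: ler_sum => f _; rewrite /g.
  by case: (_ == _); rewrite ?mul0r // mul1r; case: (_ == _).
pose bad := [set f : {ffun X -> V} | [&& injectiveb f, f j == v &
      (q`! * induced_degree G (f @: [set: X]) (f @: L))%:R
        < (p - eta) * (t ^_ q * M.+1 ^ q)%:R]].
apply: (@le_trans _ _ (\sum_(u : T | injectiveb u.1) \sum_(f | low u f) g f)).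
  rewrite (exchange_big_dep predT) //= -sum1_card natr_sum big_mkcond /=.
  apply: ler_sum => f _; case: ifP => [|_]; last by apply: sumr_ge0.
  rewrite inE => /and3P[/injectiveP fi /eqP fj hf].
  have gf : g f = 1 by rewrite /g fj eqxx card_imset // eqxx mulr1.
  have [u /andP[u1 ul]] : exists u : T, injectiveb u.1 && low u f.
    apply: contrapT => nex; move: hf; apply/negP; rewrite -leNgt.
    apply: (dense_of_shifts fi ii rq) => tau s ti.
    rewrite leNgt; apply/negP => h; apply: nex; exists (tau, s).
    by rewrite /low h andbT; apply/injectiveP.
  rewrite gf (bigD1 u) /= ?u1 ?ul // lerDl; apply: sumr_ge0 => *; exact: ler01.
apply: (@le_trans _ _ (\sum_(u : T | injectiveb u.1)
   expR (- (eta ^+ 2 / 4 * M.+1%:R)) * (#|V| ^ #|X|.-1)%:R)).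
  by apply: ler_sum => u /injectiveP; exact: key.
rewrite sumr_const -[leLHS]mulr_natl mulrA.
rewrite ler_wpM2r // ler_wpM2r ?expR_ge0 // ler_nat.
apply: leq_trans (max_card _) _.
by rewrite card_prod !card_ffun !card_ord.
Qed.

(** The threshold [d] is inclusive because [admissible] asks for a strict
    inequality of the minimum degree. *)
Definition sparse (R : realType) (l r : nat) (V : finType) (G : hypergraph r V) (d : R)
    (U : {set V}) : bool :=
  [exists L : {set V}, [&& L \subset U, #|L| == l & (induced_degree G U L)%:R <= d]].

Lemma exists_injection_avoiding (T X : finType) (B : {set X}) :
  (#|T| + #|B| <= #|X|)%N ->
  exists iota : T -> X, injective iota /\ forall u, iota u \notin B.
Proof.
move=> h; have le : (#|T| <= #|~: B|)%N by rewrite cardsCs setCK; lia.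
exists (fun u => enum_val (widen_ord le (enum_rank u))); split=> [u u' /enum_val_inj|u].
  by move=> /(congr1 val) /= /val_inj /enum_rank_inj.
by have := enum_valP (widen_ord le (enum_rank u)); rewrite inE.
Qed.

Lemma card_injections_onto (V : finType) m (U : {set V}) :
  #|U| = m ->
  #|[set f : {ffun 'I_m -> V} | injectiveb f & f @: [set: 'I_m] == U]| = m`!.
Proof.
move=> Um; have := @card_tuples_onto V m set0 U (finset.sub0set _).
rewrite cards0 add0n => /(_ Um) <-; apply: eq_card => f; rewrite !inE finset.set0U.
case: eqP => [fU|_]; last by rewrite andbF.
rewrite andbT; apply/injectiveP => i i'.
have /imset_injP fi : #|f @: [set: 'I_m]| == #|[set: 'I_m]| by rewrite fU Um cardsT card_ord.
by apply: fi; rewrite inE.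
Qed.

(** Every sparse set [U] containing [v] is the image of [m`!] injections
    ['I_m -> V], each of which sends some coordinate [j] to [v] and some [L] to a
    set of low degree; the union bound runs over [j] and [L]. *)
Lemma card_sparse_sets (R : realType) l r q (V : finType) (G : hypergraph r V)
    m t M (v : V) (p eta d : R) :
  r = (l + q)%N -> (t * M.+1 + l < m)%N -> 0 <= eta -> eta <= p -> p <= 1 ->
  (forall S : {set V}, #|S| = l -> p * (#|V| ^ q)%:R <= (degree G S * q`!)%:R) ->
  q`!%:R * d < (p - eta) * (t ^_ q * M.+1 ^ q)%:R ->
  #|[set U : {set V} | [&& #|U| == m, v \in U & sparse l G d U]]|%:R * m`!%:R
    <= m%:R * ('C(m, l) * (t ^ q * M.+1 ^ q))%:R
       * expR (- (eta ^+ 2 / 4 * M.+1%:R)) * (#|V| ^ m.-1)%:R.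
Proof.
move=> rq tm eta0 etap p1 degG dlt.
have V0 : (0 < #|V|)%N by apply/card_gt0P; exists v.
pose low (L : {set 'I_m}) (j : 'I_m) := [set f : {ffun 'I_m -> V} | [&& injectiveb f, f j == v &
      (q`! * induced_degree G (f @: [set: 'I_m]) (f @: L))%:R
        < (p - eta) * (t ^_ q * M.+1 ^ q)%:R]].
have lowle (L : {set 'I_m}) j : #|L| = l -> #|low L j|%:R <= (t ^ q * M.+1 ^ q)%:R
    * expR (- (eta ^+ 2 / 4 * M.+1%:R)) * (#|V| ^ m.-1)%:R.
  move=> Ll.
  have [|iota [ii iL]] := @exists_injection_avoiding ('I_t * 'I_M.+1)%type 'I_m (j |: L).
    by rewrite card_prod !card_ord cardsU1 Ll; case: (_ \notin _); lia.
  have := @sum_low_induced_degree R r 'I_m V G L q j v t M iota p eta V0 ii iL.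
  by rewrite Ll card_ord; apply.
pose BU := [set U : {set V} | [&& #|U| == m, v \in U & sparse l G d U]].
have cover : (#|BU| * m`! <=
    \sum_(j < m) \sum_(L : {set 'I_m} | #|L| == l) #|low L j|)%N.
  have -> : (#|BU| * m`! = #|[set f : {ffun 'I_m -> V} |
       injectiveb f & f @: [set: 'I_m] \in BU]|)%N.
    rewrite -[RHS]sum1dep_card.
    rewrite (partition_big (fun f : {ffun 'I_m -> V} => f @: [set: 'I_m]) (mem BU)) /=;
      last by move=> f /andP[].
    rewrite -sum_nat_const; apply: eq_bigr => U UB.
    have Um : #|U| = m by move: UB; rewrite inE => /and3P[/eqP].
    rewrite -(card_injections_onto Um) -sum1dep_card; apply: eq_bigl => f.
    by case: eqP => [->|]; rewrite ?andbF ?UB ?andbT.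
  apply: leq_trans (_ : (#|\bigcup_(j < m) \bigcup_(L : {set 'I_m} | #|L| == l) low L j| <= _)%N).
    apply: subset_leq_card; apply/subsetP => f.
    rewrite inE => /andP[/injectiveP fi]; rewrite inE => /and3P[_ vf].
    case/existsP => S /and3P[Sf /eqP Sl Sd].
    case/imsetP: vf => j _ vj; apply/bigcupP; exists j => //.
    have fL : f @: (f @^-1: S) = S.
      apply/setP => y; apply/imsetP/idP => [[x]|yS]; first by rewrite inE => ? ->.
      by have /imsetP[x _ yx] := subsetP Sf _ yS; exists x; rewrite // inE -yx.
    apply/bigcupP; exists (f @^-1: S).
      by rewrite -(card_imset _ fi) fL Sl.
    rewrite inE vj eqxx fL /= natrM; apply/andP; split; first exact/injectiveP.
    by apply: le_lt_trans dlt; rewrite ler_wpM2l.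
  apply: leq_trans (card_bigcup_le _ _) _; apply: leq_sum => j _; exact: card_bigcup_le.
rewrite -natrM; apply: (@le_trans _ _
  (\sum_(j < m) \sum_(L : {set 'I_m} | #|L| == l) #|low L j|)%:R).
  by rewrite ler_nat.
rewrite natr_sum; apply: (@le_trans _ _ (\sum_(j < m) \sum_(L : {set 'I_m} | #|L| == l)
   (t ^ q * M.+1 ^ q)%:R * expR (- (eta ^+ 2 / 4 * M.+1%:R)) * (#|V| ^ m.-1)%:R)).
  apply: ler_sum => j _; rewrite natr_sum; apply: ler_sum => L /eqP Ll; exact: lowle.
under eq_bigr do rewrite sumr_const.
rewrite sumr_const card_ord.
have -> : #|[pred L : {set 'I_m} | #|L| == l]| = 'C(m, l).
  by rewrite -[in RHS](card_ord m) -card_draws; apply: eq_card => L; rewrite !inE.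
rewrite -mulrnA -[leLHS]mulr_natl !natrM; rewrite le_eqVlt; apply/orP; left; apply/eqP.
by ring.
Qed.

(** * Choice of the constants *)

Lemma bernoulli_sub (R : realFieldType) (x : R) n :
  0 <= x -> x <= 1 -> 1 - n%:R * x <= (1 - x) ^+ n.
Proof.
move=> x0 x1; elim: n => [|n IH]; first by rewrite expr0 mul0r subr0.
rewrite exprS -natr1; have n0 : 0 <= n%:R :> R by [].
have : 0 <= (1 - x) * ((1 - x) ^+ n - (1 - n%:R * x)) by apply: mulr_ge0; lra.
move: ((1 - x) ^+ n) IH => P IH h.
have : 0 <= n%:R * x * x by rewrite !mulr_ge0.
by nra.
Qed.

Lemma leq_exp_ffact n k : ((n - k) ^ k <= n ^_ k)%N.
Proof.
elim: k n => [|k IH] n; first by rewrite ffactn0.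
rewrite ffactnS expnS leq_mul ?leq_subr //.
by rewrite (_ : (n - k.+1 = n.-1 - k)%N) //; lia.
Qed.

(** This compares [#|V| ^ m], which counts functions, with the binomial
    coefficients of [good_partition], at the cost of a factor two. *)
Lemma exp_leq_twice_ffact m : exists n1, forall n, (n1 <= n)%N ->
  (n ^ m <= 2 * (n.-1 - m.+1) ^_ m)%N.
Proof.
pose y := (m + m.+2)%N; exists (2 * m * y + y + 1)%N => n hn.
apply: leq_trans (_ : 2 * (n - y) ^ m <= _)%N; last first.
  rewrite leq_mul2l /=; apply: leq_trans (leq_exp_ffact _ _).
  by rewrite (_ : (n.-1 - m.+1 - m = n - y)%N) // /y; lia.
have yn : (y <= n)%N by lia.
have n0 : 0 < n%:R :> rat by rewrite ltr0n; lia.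
have x1 : y%:R / n%:R <= 1 :> rat by rewrite ler_pdivrMr // mul1r ler_nat.
have x0 : 0 <= y%:R / n%:R :> rat by rewrite divr_ge0.
have := bernoulli_sub m x0 x1.
have -> : 1 - y%:R / n%:R = (n%:R - y%:R) / n%:R :> rat by field; lra.
rewrite expr_div_n ler_pdivlMr ?exprn_gt0 // => h.
rewrite -(ler_nat rat) natrM !natrX natrB //.
have hm : m%:R * (y%:R / n%:R) <= 2^-1 :> rat.
  rewrite mulrA ler_pdivrMr // -ler_pdivrMl ?invr_gt0 // invrK -!natrM ler_nat.
  by rewrite mulnA; lia.
have : 0 <= n%:R ^+ m :> rat by rewrite exprn_ge0 // ltW.
by nra.
Qed.

Lemma exp_decay (R : realType) (c : R) k : 0 < c ->
  exists m0, forall m, (m0 <= m)%N -> m%:R ^+ k <= expR (c * m%:R).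
Proof.
move=> c0; pose K := k.+1`!%:R / c ^+ k.+1.
exists (Num.truncn K).+1 => m hm.
have Km : K <= m%:R.
  apply: ltW; apply: lt_le_trans (truncnS_gt K) _; by rewrite ler_nat.
have y0 : 0 <= c * m%:R by rewrite mulr_ge0 // ltW.
apply: le_trans (_ : (c * m%:R) ^+ k.+1 / k.+1`!%:R <= _); last first.
  by have := expR_ge1Dxn k y0; lra.
have f0 : 0 < k.+1`!%:R :> R by rewrite ltr0n fact_gt0.
rewrite ler_pdivlMr // exprMn [m%:R ^+ k.+1]exprS mulrA mulrC ler_wpM2r ?exprn_ge0 //.
by rewrite mulrC -ler_pdivrMr // exprn_gt0.
Qed.

(** The number [t] of classes depends only on [eps] and [q]; then [M.+1] is about
    [m / t].  All but a proportion [eps / 4] of the ordered [q]-tuples are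
    transversal to the classes, and the exponential gain of the Chernoff bound
    beats the polynomial number of events. *)
Lemma sampling_parameters (R : realType) (l q : nat) (eps : R) :
  0 < eps -> eps <= 1 ->
  exists t m0, forall m, (m0 <= m)%N -> exists M,
  [/\ (t * M.+1 + l < m)%N,
      (1 - eps / 4) * m%:R ^+ q <= (t ^_ q * M.+1 ^ q)%:R
    & (64 * m * ('C(m, l) * (t ^ q * M.+1 ^ q)))%:R
        * expR (- (eps ^+ 2 / 16 * M.+1%:R)) <= 1 ].
Proof.
move=> e0 e1.
pose t := (Num.truncn (8 * q%:R ^+ 2 / eps : R) + q).+1.
have tq : 8 * q%:R ^+ 2 / eps <= t%:R.
  apply: ltW; apply: lt_le_trans (truncnS_gt _) _.
  by rewrite ler_nat /t ltnS leq_addr.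
have qt : (q <= t)%N by rewrite /t; lia.
have t0 : 0 < t%:R :> R by rewrite ltr0n.
pose c := eps ^+ 2 / (32 * t%:R).
have c0 : 0 < c by rewrite divr_gt0 ?exprn_gt0 // mulr_gt0.
have [m1 hm1] := exp_decay (l + q).+2 c0.
pose z := 8 * q%:R * (l + 1 + t)%:R / eps : R.
exists t, (m1 + Num.truncn z + 64 + 2 * (l + 1 + t) + t + l + 1)%N => m hm.
pose M1 := ((m - l.+1) %/ t)%N.
have M10 : (0 < M1)%N by rewrite divn_gt0 //; lia.
have M1t : (t * M1 <= m - l.+1)%N by rewrite mulnC leq_divM.
have M1t' : (m - l.+1 < t * M1 + t)%N by rewrite mulnC -mulSnr ltn_ceil.
exists M1.-1; rewrite prednK //.
have m0 : 0 < m%:R :> R by rewrite ltr0n; lia.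
split; first by lia.
(* the proportion of tuples lost: coincident classes contribute [q / t], and
   the coordinates outside the classes contribute [(l + 1 + t) / m] *)
- pose x := q%:R / t%:R + (l + 1 + t)%:R / m%:R : R.
  have qx : q%:R * x <= eps / 4.
    rewrite /x mulrDr.
    have h1 : q%:R * (q%:R / t%:R) <= eps / 8.
      rewrite mulrA -expr2 ler_pdivrMr // -ler_pdivrMl; last by rewrite divr_gt0.
      by rewrite invf_div mulrAC.
    have h2 : q%:R * ((l + 1 + t)%:R / m%:R) <= eps / 8.
      rewrite mulrA ler_pdivrMr // -ler_pdivrMl; last by rewrite divr_gt0.
      rewrite invf_div.
      rewrite (_ : _ * _ = z); last by rewrite /z; ring.
      by apply: ltW; apply: lt_le_trans (truncnS_gt _) _; rewrite ler_nat; move: hm; move: (Num.truncn z); lia.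
    lra.
  have x0 : 0 <= x by rewrite addr_ge0 // divr_ge0.
  have [q0|q0] := posnP q.
    by rewrite q0 !expr0 ffactn0 expn0 mulr1; lra.
  have x1 : x <= 1.
    have : 1 * x <= q%:R * x by rewrite ler_wpM2r // ler1n.
    by lra.
  have h1 : (t - q)%:R * M1%:R >= m%:R * (1 - x) :> R.
    have e : m%:R * (1 - x) = m%:R - q%:R * (m%:R / t%:R) - (l + 1 + t)%:R.
      by rewrite /x; field; rewrite !lt0r_neq0.
    have a1 : M1%:R <= m%:R / t%:R :> R.
      by rewrite ler_pdivlMr // -natrM ler_nat mulnC; apply: leq_trans M1t _; lia.
    have a2 : (m%:R : R) <= t%:R * M1%:R + (l + 1 + t)%:R.
      by rewrite -natrM -natrD ler_nat; lia.
    rewrite e natrB // mulrBl.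
    have : q%:R * M1%:R <= q%:R * (m%:R / t%:R) :> R by rewrite ler_wpM2l.
    by lra.
  apply: le_trans (_ : ((t - q)%:R * M1%:R) ^+ q <= _); last first.
    rewrite exprMn natrM -!natrX -!natrM ler_nat leq_mul2r leq_exp_ffact orbT //.
  apply: le_trans (_ : (m%:R * (1 - x)) ^+ q <= _); last first.
    by rewrite lerXn2r ?nnegrE ?mulr_ge0 // ?subr_ge0.
  rewrite exprMn mulrC ler_wpM2l ?exprn_ge0 //.
  by apply: le_trans (bernoulli_sub q x0 x1); lra.
- have hcm : c * m%:R <= eps ^+ 2 / 16 * M1%:R.
    have h : m%:R <= 2 * (t%:R * M1%:R) :> R.
      rewrite -!natrM ler_nat; move: M1t' hm; move: (t * M1)%N => tM; lia.
    have -> : c * m%:R = eps ^+ 2 / 16 * (m%:R / (2 * t%:R)).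
      by rewrite /c; field; rewrite lt0r_neq0.
    rewrite ler_wpM2l //; first by rewrite divr_ge0 // exprn_ge0 // ltW.
    by rewrite ler_pdivrMr ?mulr_gt0 //; lra.
  rewrite expRN ler_pdivrMr ?expR_gt0 // mul1r.
  apply: le_trans (_ : expR (c * m%:R) <= _); last by rewrite ler_expR.
  apply: le_trans (hm1 m _); last by lia.
  rewrite -natrX ler_nat.
  apply: leq_trans (_ : m * m * (m ^ l * m ^ q) <= _)%N; last first.
    by rewrite -expnD -!mulnA -!expnS.
  apply: leq_mul; first by rewrite leq_mul2r; apply/orP; right; lia.
  apply: leq_mul; first exact: bin_leq_exp.
  rewrite -expnMn; have [->|q0] := posnP q; first by rewrite !expn0.
  by rewrite leq_exp2r //; lia.
Qed.

(** * Pullbacks of hypergraphs and tilings by copies *)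

(** Requiring [#|e| == r] makes the pullback uniform for every [f], injective or
    not. *)
Definition pullback_edges r (X V : finType) (f : X -> V) (G : hypergraph r V) :
    {set {set X}} := [set e : {set X} | (#|e| == r) && (f @: e \in edges G)].

Lemma pullback_uniform r (X V : finType) (f : X -> V) (G : hypergraph r V) :
  {in pullback_edges f G, forall e : {set X}, #|e| = r}.
Proof. by move=> e; rewrite inE => /andP[/eqP]. Qed.

Definition pullback r (X V : finType) (f : X -> V) (G : hypergraph r V) :
  hypergraph r X := Hypergraph (@pullback_uniform r X V f G).

Lemma mem_pullback r (X V : finType) (f : X -> V) (G : hypergraph r V) (e : {set X}) :
  injective f -> (e \in edges (pullback f G)) = (f @: e \in edges G).
Proof.
move=> fi; rewrite inE; apply: andb_idl => /edges_uniform.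
by rewrite card_imset // => ->.
Qed.

Lemma card_pullback_edges r (X V : finType) (f : X -> V) (G : hypergraph r V)
    (P : pred {set V}) : injective f ->
  #|[set e in edges (pullback f G) | P (f @: e)]|
    = #|[set e in edges G | P e && (e \subset f @: [set: X])]|.
Proof.
move=> fi; rewrite -(card_imset _ (imset_inj fi)); apply: eq_card => e.
rewrite inE; apply/imsetP/and3P => [[e' + ->]|[eG Pe ef]].
  by rewrite inE mem_pullback // => /andP[-> ->]; rewrite imsetS ?finset.subsetT.
have fe : e = f @: (f @^-1: e).
  apply/setP => y; apply/idP/imsetP => [ye|[x]]; last by rewrite inE => ? ->.
  by have /imsetP[x _ yx] := subsetP ef _ ye; exists x; rewrite // inE -yx.
by exists (f @^-1: e) => //; rewrite inE mem_pullback // -fe eG.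
Qed.

Lemma imsetS_inj (X V : finType) (f : X -> V) (A B : {set X}) :
  injective f -> (f @: A \subset f @: B) = (A \subset B).
Proof.
move=> fi; apply/idP/idP => [/subsetP h|]; last exact: imsetS.
by apply/subsetP => x xA; rewrite -(mem_imset _ _ fi) h // imset_f.
Qed.

Lemma degree_pullback r (X V : finType) (f : X -> V) (G : hypergraph r V) (L : {set X}) :
  injective f -> degree (pullback f G) L = induced_degree G (f @: [set: X]) (f @: L).
Proof.
move=> fi; rewrite /degree /induced_degree.
rewrite -(@card_pullback_edges _ _ _ f G (fun e => f @: L \subset e)) //.
by apply: eq_card => e; rewrite !inE imsetS_inj.
Qed.

(** Unlike [is_factor], this form composes under disjoint unions and passes to
    subfamilies; the number of copies is then determined by [U]. *)
Definition tiling r (W V : finType) (H : hypergraph r W) (G : hypergraph r V)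
    (U : {set V}) (T : {set {set V} * {set {set V}}}) : Prop :=
  [/\ forall c, c \in T -> is_copy H G c,
      forall c c', c \in T -> c' \in T -> c != c' -> [disjoint c.1 & c'.1]
    & \bigcup_(c in T) c.1 = U].

Lemma is_copy_card r (W V : finType) (H : hypergraph r W) (G : hypergraph r V) c :
  is_copy H G c -> #|c.1| = #|W|.
Proof. by case=> _ [f [fi -> _]]; rewrite card_imset // cardsT. Qed.

Lemma is_copy_sub r (W V : finType) (H : hypergraph r W) (G : hypergraph r V) c e :
  is_copy H G c -> e \in c.2 -> e \in edges G /\ e \subset c.1.
Proof.
case=> /subsetP sG [f [fi -> cf]] ec; split; first exact: sG.
by move: ec; rewrite cf => /imsetP[e0 _ ->]; rewrite imsetS ?finset.subsetT.
Qed.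

Lemma card_disjoint_union r (W V : finType) (H : hypergraph r W) (G : hypergraph r V)
    (T : {set {set V} * {set {set V}}}) :
  (forall c, c \in T -> is_copy H G c) ->
  (forall c c', c \in T -> c' \in T -> c != c' -> [disjoint c.1 & c'.1]) ->
  #|\bigcup_(c in T) c.1| = (#|T| * #|W|)%N.
Proof.
move=> cT dT; rewrite -sum_nat_const.
transitivity (\sum_(c in T) \sum_(x in \bigcup_(c in T) c.1 | x \in c.1) 1)%N; last first.
  apply: eq_bigr => c cin; rewrite sum1_card -(is_copy_card (cT c cin)); apply: eq_card => x.
  apply/andP/idP => [[]//|xc]; split=> //.
  by apply/bigcupP; exists c.
rewrite (exchange_big_dep (mem (\bigcup_(c in T) c.1))) /=; last by move=> ? ? _ /andP[].
rewrite -sum1_card.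
apply: eq_bigr => x /bigcupP[c cin xc]; rewrite (bigD1 c) /= ?cin ?xc //.
- rewrite big1 // => c' /andP[/andP[c'T /andP[_ xc']] ne].
  by have := disjointFr (dT _ _ cin c'T _) xc; rewrite eq_sym ne xc' => /(_ isT).
by rewrite andbT; apply/bigcupP; exists c.
Qed.

Lemma tiling_card r (W V : finType) (H : hypergraph r W) (G : hypergraph r V) U T :
  tiling H G U T -> #|U| = (#|T| * #|W|)%N.
Proof. by case=> cT dT <-; exact: card_disjoint_union cT dT. Qed.

Lemma tiling_of_factor r (W V : finType) (H : hypergraph r W) (G : hypergraph r V) T :
  (#|W| %| #|V|)%N -> is_factor H G T -> tiling H G [set: V] T.
Proof.
move=> WV [cT dT Tn]; split=> //; apply/eqP; rewrite eqEcard finset.subsetT.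
by rewrite cardsT (card_disjoint_union cT dT) Tn divnK /=.
Qed.

Lemma factor_of_tiling r (W V : finType) (H : hypergraph r W) (G : hypergraph r V) T :
  (0 < #|W|)%N -> tiling H G [set: V] T -> is_factor H G T.
Proof.
move=> W0 tT; have := tiling_card tT; case: tT => cT dT _; rewrite cardsT => e.
by split=> //; rewrite e mulnK.
Qed.

Definition tiling_edges (V : finType) (T : {set {set V} * {set {set V}}}) :
  {set {set V}} := \bigcup_(c in T) c.2.

Lemma tiling_edgesP r (W V : finType) (H : hypergraph r W) (G : hypergraph r V) U T e :
  tiling H G U T -> e \in tiling_edges T -> e \in edges G /\ e \subset U.
Proof.
case=> cT _ <- /bigcupP[c cin ec]; have [eG ec1] := is_copy_sub (cT _ cin) ec.
by split=> //; apply: subset_trans ec1 (bigcup_sup _ cin).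
Qed.

Definition copy_image (X V : finType) (f : X -> V) (c : {set X} * {set {set X}}) :
  {set V} * {set {set V}} := (f @: c.1, [set f @: (e : {set X}) | e in c.2]).

Lemma tiling_image r (W X V : finType) (H : hypergraph r W) (G : hypergraph r V)
    (f : X -> V) U T :
  injective f -> tiling H (pullback f G) U T ->
  tiling H G (f @: U) [set copy_image f c | c in T].
Proof.
move=> fi [cT dT UT]; split.
- move=> _ /imsetP[c cin ->]; have [sG [k [ki c1 c2]]] := cT _ cin; split.
    apply/subsetP => _ /imsetP[e ec ->].
    by rewrite -mem_pullback //; exact: (subsetP sG).
  exists (f \o k); split; first exact: inj_comp.
    by rewrite /= c1 -imset_comp.
  by rewrite /= c2 -imset_comp; apply: eq_imset => e /=; rewrite -imset_comp.
- move=> _ _ /imsetP[c cin ->] /imsetP[c' c'in ->] ne.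
  rewrite /= imset_disjoint //.
  by apply: dT => //; apply: contraNneq ne => ->.
- apply/setP => y; apply/bigcupP/imsetP.
    case=> _ /imsetP[c cin ->] /imsetP[x xc ->]; exists x => //.
    by rewrite -UT; apply/bigcupP; exists c.
  rewrite -UT => -[x /bigcupP[c cin xc] ->].
  by exists (copy_image f c); apply: imset_f.
Qed.

Lemma tiling_edges_image (X V : finType) (f : X -> V)
    (T : {set {set X} * {set {set X}}}) e :
  e \in tiling_edges [set copy_image f c | c in T] ->
  exists2 e0, e0 \in tiling_edges T & e = f @: e0.
Proof.
case/bigcupP => _ /imsetP[c cin ->] /imsetP[e0 e0c ->].
by exists e0 => //; apply/bigcupP; exists c.
Qed.

Lemma subtiling r (W V : finType) (H : hypergraph r W) (G : hypergraph r V) U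
    (T T' : {set {set V} * {set {set V}}}) :
  tiling H G U T -> T' \subset T -> tiling H G (\bigcup_(c in T') c.1) T'.
Proof. by case=> cT dT _ /subsetP s; split=> // [c /s|c c' /s + /s]; [exact: cT | exact: dT]. Qed.

Lemma tilingU r (W V : finType) (H : hypergraph r W) (G : hypergraph r V)
    (U U' : {set V}) (T T' : {set {set V} * {set {set V}}}) :
  [disjoint U & U'] -> tiling H G U T -> tiling H G U' T' ->
  tiling H G (U :|: U') (T :|: T').
Proof.
move=> UU' tT tT'; have [cT dT UT] := tT; have [cT' dT' UT'] := tT'.
split; [by move=> c /setUP[/cT|/cT'] | | by rewrite bigcup_setU UT UT'].
have dis c c' : c \in T -> c' \in T' -> [disjoint c.1 & c'.1].
  move=> cin c'in; apply: disjointWl (_ : c.1 \subset U) _; first by rewrite -UT bigcup_sup.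
  by apply: disjointWr UU'; rewrite -UT' bigcup_sup.
move=> c c' /setUP[c1|c1] /setUP[c2|c2] ne; [exact: dT | exact: dis | | exact: dT'].
by rewrite disjoint_sym; exact: dis.
Qed.

Lemma tiling_edgesU (V : finType) (T T' : {set {set V} * {set {set V}}}) :
  tiling_edges (T :|: T') = tiling_edges T :|: tiling_edges T'.
Proof. exact: bigcup_setU. Qed.

Lemma tiling_of_parts r (W V : finType) (H : hypergraph r W) (G : hypergraph r V)
    (M : {set {set V}}) :
  trivIset M -> (forall U, U \in M -> exists T, tiling H G U T) ->
  exists T, tiling H G (cover M) T /\
    (forall e, e \in tiling_edges T -> exists2 U, U \in M & e \subset U).
Proof.
have [k] := ubnP #|M|; elim: k M => // k IH M Mk tM hM.
have [->|/set0Pn[U UM]] := eqVneq M set0.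
  exists set0; split; last by move=> e; rewrite /tiling_edges big_set0 inE.
  by split=> [c|c c'|]; rewrite ?inE // /cover !big_set0.
have [|||T [tT sT]] := IH (M :\ U).
- by move: Mk; rewrite (cardsD1 U) UM.
- by apply: trivIsetS tM; exact: subsetDl.
- by move=> U'; rewrite inE => /andP[_]; exact: hM.
have [TU tTU] := hM _ UM.
exists (TU :|: T); split.
  have -> : cover M = U :|: cover (M :\ U) by rewrite /cover (big_setD1 U).
  apply: tilingU => //; rewrite /cover bigcup_disjoint // => U'.
  rewrite !inE => /andP[ne U'M]; rewrite disjoint_sym.
  by move/trivIsetP: tM; apply; rewrite // eq_sym.
move=> e; rewrite tiling_edgesU => /setUP[eU|/sT[U']].
  by exists U => //; have [] := tiling_edgesP tTU eU.
by rewrite inE => /andP[_]; exists U'.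
Qed.

(** The hypergraph induced on [U] is the pullback along the inclusion; it has as
    many vertices as [admissible] requires, and large minimum degree because [U]
    is not sparse. *)
Lemma tiling_of_dense (R : realType) l r (W V : finType) (H : hypergraph r W)
    (G : hypergraph r V) (U : {set V}) (d : R) :
  admissible l H #|U| d -> (#|W| %| #|U|)%N -> (l <= #|U|)%N ->
  ~~ sparse l G (d * #|U|%:R ^+ (r - l)) U -> exists T, tiling H G U T.
Proof.
move=> [_ adm] WU lU dense.
pose X : finType := {x : V | x \in U}; pose f : X -> V := val.
have fi : injective f by exact: val_inj.
have cX : #|X| = #|U| by rewrite card_sig; apply: eq_card.
have fX : f @: [set: X] = U.
  by apply/setP => x; apply/imsetP/idP => [[y _ ->]|xU]; [exact: valP | exists (Sub x xU)].
have [|T /tiling_of_factor tT] := adm X (pullback f G) cX; last first.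
  by exists [set copy_image f c | c in T]; rewrite -fX;
    apply: tiling_image => //; apply: tT; rewrite cX.
rewrite ltNge; apply/negP => le_.
have : ((min_degree l (pullback f G)).+1 <= min_degree l (pullback f G))%N.
  apply/(@min_degreeP l r X (pullback f G)); first by rewrite cX.
  move=> L Ll; rewrite -(ltr_nat R); apply: le_lt_trans le_ _.
  rewrite degree_pullback // fX ltNge; apply: contra dense => h.
  apply/existsP; exists (f @: L); rewrite h card_imset // Ll eqxx !andbT.
  by rewrite -fX imsetS ?finset.subsetT.
by rewrite ltnn.
Qed.

(** * Rainbow tilings when the block size divides the order *)

Lemma card_link_le r q (V : finType) (G : hypergraph r V) (S : {set V}) :
  r = (#|S| + q)%N -> (degree G S * q`! <= #|V| ^ q)%N.
Proof.
move=> rq; pose f : {ffun V -> V} := [ffun x => x].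
have fS : f @: S = S by rewrite -[RHS]imset_id; apply: eq_imset => x; rewrite ffunE.
have := @card_link_tuples r V V G S q f; rewrite fS => <- //.
by apply: leq_trans (max_card _) _; rewrite card_ffun card_ord.
Qed.

(** A random block at [v] inherits the minimum degree condition up to the loss
    from [al] to [be], except with probability [1 / (32 * m.+1)]. *)
Lemma sparse_rare (R : realType) (l q : nat) (eps : R) : 0 < eps -> eps <= 1 ->
  exists m0, forall m, (m0 <= m)%N ->
  forall (V : finType) (G : hypergraph (l + q) V) (al be : R),
    (l <= #|V|)%N -> (#|V| ^ m <= 2 * (#|V|.-1 - m.+1) ^_ m)%N ->
    0 <= be -> be + eps <= al ->
    (forall S : {set V}, #|S| = l -> al * #|V|%:R ^+ q <= (degree G S)%:R) ->
  forall v,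
    #|[set U : {set V} | [&& #|U| == m.+1, v \in U
        & sparse l G (be * m.+1%:R ^+ q) U]]|%:R
      <= (32 * m.+1%:R)^-1 * ('C(#|V|.-1, m))%:R :> R.
Proof.
move=> e0 e1; have [t [m0 hm0]] := sampling_parameters l q e0 e1.
exists m0 => m mm0 V G al be lV nm be0 beal degG v.
have [|M [tM lowTM decay]] := hm0 m.+1; first exact: leqW.
have V0 : (0 < #|V|)%N by apply/card_gt0P; exists v.
have nq0 : 0 < #|V|%:R ^+ q :> R by rewrite exprn_gt0 // ltr0n.
have f1 : 1 <= q`!%:R :> R by rewrite ler1n fact_gt0.
have degG' (S : {set V}) : #|S| = l -> q`!%:R * al * (#|V| ^ q)%:R <= (degree G S * q`!)%:R.
  move=> Sl; rewrite natrM natrX -mulrA mulrC ler_wpM2r // ?degG //; lra.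
have [S Sl] : exists S : {set V}, #|S| = l.
  have : (0 < #|[set S : {set V} | #|S| == l]|)%N by rewrite card_draws bin_gt0.
  by case/card_gt0P => S; rewrite inE => /eqP; exists S.
(* a degree times [q`!] counts ordered tuples, so it is at most [#|V| ^ q] *)
have p1 : q`!%:R * al <= 1.
  rewrite -(ler_pM2r nq0) mul1r -natrX; apply: le_trans (degG' S Sl) _.
  by rewrite ler_nat card_link_le ?Sl.
have al1 : al <= 1 by nra.
have eta0 : 0 <= q`!%:R * eps / 2 by nra.
have etap : q`!%:R * eps / 2 <= q`!%:R * al by nra.
have mq0 : 0 < m.+1%:R ^+ q :> R by rewrite exprn_gt0.
have dlt : q`!%:R * (be * m.+1%:R ^+ q) <
    (q`!%:R * al - q`!%:R * eps / 2) * (t ^_ q * M.+1 ^ q)%:R.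
  rewrite [X in _ < X * _](_ : _ = q`!%:R * (al - eps / 2)); last by ring.
  rewrite -mulrA ltr_pM2l; last by lra.
  move: lowTM mq0; move: (m.+1%:R ^+ q) ((t ^_ q * M.+1 ^ q)%:R) => Q T lowTM mq0.
  have h1 : (al - eps / 2) * ((1 - eps / 4) * Q) <= (al - eps / 2) * T.
    by rewrite ler_wpM2l //; lra.
  apply: lt_le_trans h1; rewrite mulrA ltr_pM2r //.
  have : 0 <= (al - be - eps) * (1 - eps / 4) by apply: mulr_ge0; lra.
  by nra.
have := card_sparse_sets v (erefl _) tM eta0 etap p1 degG' dlt.
set N := #|_|; move=> h.
have decay2 : (64 * m.+1 * ('C(m.+1, l) * (t ^ q * M.+1 ^ q)))%:R *
   expR (- ((q`!%:R * eps / 2) ^+ 2 / 4 * M.+1%:R)) <= 1 :> R.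
  apply: le_trans decay; rewrite ler_wpM2l // ler_expR lerN2 ler_wpM2r //.
  have : 1 * eps <= q`!%:R * eps by rewrite ler_wpM2r // ltW.
  by move: (q`!%:R * eps) => y hy; nra.
have nm' : (#|V| ^ m)%:R <= 2 * (('C(#|V|.-1, m))%:R * m`!%:R) :> R.
  rewrite -!natrM ler_nat; apply: leq_trans nm _.
  by rewrite -bin_ffact leq_mul2l /= leq_mul2r leq_bin2l ?orbT // leq_subr.
move: h decay2; rewrite factS natrM [(64 * _ * _)%:R]natrM [(64 * _)%:R]natrM.
have := expR_ge0 (- ((q`!%:R * eps / 2) ^+ 2 / 4 * M.+1%:R)).
have : 0 < m`!%:R :> R by rewrite ltr0n fact_gt0.
have : 0 < m.+1%:R :> R by [].
have : 0 <= ('C(#|V|.-1, m))%:R :> R by [].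
have : 0 <= ('C(m.+1, l) * (t ^ q * M.+1 ^ q))%:R :> R by [].
rewrite /= in nm' *; move: nm'.
move: (expR _) (m`!%:R) (m.+1%:R) ('C(#|V|.-1, m)%:R) ((_ * (_ * _))%:R)
  ((#|V| ^ m)%:R) (N%:R) => E F m' K C n' N' nm' C0 K0 m'0 F0 E0 h dec.
rewrite mulrC ler_pdivlMr; last by rewrite mulr_gt0.
rewrite -(ler_pM2r F0).
have h1 : m' * C * E * n' <= m' * C * E * (2 * (K * F)).
  by rewrite ler_wpM2l // !mulr_ge0 // ltW.
have KF : 0 <= K * F by rewrite mulr_ge0 // ltW.
have := ler_wpM2r KF dec.
by nra.
Qed.

(** The constant [512 * 4 ^ m * m.+1`!] is chosen so that the colour conflicts
    inside a block, and later those between two blocks, each contribute at most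
    as much as the sparse sets. *)
Lemma bad_sets_rare (R : realType) (l q m : nat) (mu d : R) (V : finType)
    (G : hypergraph (l + q) V) (C : eqType) (col : {set V} -> C) (Cf : seq C) v :
  (0 < m)%N -> (1 < l + q)%N -> (#|V| ^ m <= 2 * (#|V|.-1 - m.+1) ^_ m)%N ->
  0 <= mu -> mu_bounded mu G col -> mu * (512 * 4 ^ m * m.+1`!)%:R <= 1 ->
  (size Cf <= 2 ^ m.+1)%N ->
  #|[set U : {set V} | [&& #|U| == m.+1, v \in U & sparse l G d U]]|%:R
      <= (32 * m.+1%:R)^-1 * ('C(#|V|.-1, m))%:R :> R ->
  #|[set U : {set V} | [&& #|U| == m.+1, v \in U
        & sparse l G d U || color_bad G col Cf U]]|%:R
      <= (16 * m.+1%:R)^-1 * ('C(#|V|.-1, m))%:R :> R.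
Proof.
move=> m0 r1 nm mu0 bd muS szC hs.
have hc := card_color_bad Cf v r1 m0 mu0 bd.
pose X1 := [set U : {set V} | [&& #|U| == m.+1, v \in U & sparse l G d U]].
pose X2 := [set U : {set V} | [&& #|U| == m.+1, v \in U & color_bad G col Cf U]].
apply: (@le_trans _ _ (#|X1|%:R + #|X2|%:R)).
  rewrite -natrD ler_nat; apply: leq_trans (leq_card_setU _ _).
  apply: subset_leq_card; apply/subsetP => U; rewrite !inE => /and3P[-> ->].
  by rewrite !andTb.
have nm' : (#|V| ^ m)%:R <= 2 * (('C(#|V|.-1, m))%:R * m`!%:R) :> R.
  rewrite -!natrM ler_nat; apply: leq_trans nm _.
  by rewrite -bin_ffact leq_mul2l /= leq_mul2r leq_bin2l ?orbT // leq_subr.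
have h2 : #|X2|%:R <= (32 * m.+1%:R)^-1 * ('C(#|V|.-1, m))%:R :> R.
  apply: le_trans hc _; rewrite -natrX.
  apply: (@le_trans _ _ ((3 * 4 ^ m)%:R * mu * (2 * (('C(#|V|.-1, m))%:R * m`!%:R)))).
    apply: ler_pM => //; first by rewrite mulr_ge0.
    rewrite ler_wpM2r // ler_nat -[4%N]/(2 * 2)%N expnMn mulnCA leq_mul2l.
    by rewrite expnS in szC; lia.
  rewrite [leRHS]mulrC ler_pdivlMr; last by rewrite mulr_gt0.
  have T0 : 0 <= mu * (4 ^ m * 'C(#|V|.-1, m) * m`! * m.+1)%:R by rewrite mulr_ge0.
  have := ler_wpM2l (ler0n R 'C(#|V|.-1, m)) muS.
  by move: T0; rewrite factS !natrM; nra.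
have -> : (16 * m.+1%:R)^-1 = (32 * m.+1%:R)^-1 + (32 * m.+1%:R)^-1 :> R.
  by rewrite !invfM; move: (m.+1%:R^-1) => y; lra.
by rewrite mulrDl; exact: lerD.
Qed.

Lemma exists_good_set (R : realType) (l q m : nat) (d : R) (V : finType)
    (G : hypergraph (l + q) V) (C : eqType) (col : {set V} -> C) (v : V) :
  (m < #|V|)%N ->
  #|[set U : {set V} | [&& #|U| == m.+1, v \in U
        & sparse l G d U || color_bad G col [::] U]]|%:R
      <= (16 * m.+1%:R)^-1 * ('C(#|V|.-1, m))%:R :> R ->
  exists U : {set V}, [/\ #|U| = m.+1, ~~ sparse l G d U & ~~ color_bad G col [::] U].
Proof.
move=> mV h.
have K0 : (0 < 'C(#|V|.-1, m))%N by rewrite bin_gt0; lia.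
apply: contrapT => no; move: h; apply/negP; rewrite -ltNge.
have -> : #|[set U : {set V} | [&& #|U| == m.+1, v \in U
        & sparse l G d U || color_bad G col [::] U]]| = 'C(#|V|.-1, m).
  have := @card_pointed_sets m V set0 v; rewrite inE cards0 subn1 => <- //.
  apply: eq_card => U; rewrite !inE -setI_eq0 setI0 eqxx andbT andbCA.
  congr (_ && _); apply/andP/idP => [[] //|Um]; split=> //.
  apply: contraT; rewrite negb_or => /andP[s c]; exfalso; apply: no.
  by exists U; split=> //; exact/eqP.
rewrite -[ltRHS]mul1r ltr_pM2r ?ltr0n // invf_lt1; last by rewrite mulr_gt0.
by rewrite -natrM ltr1n; lia.
Qed.

(** A partition from [good_partition] into blocks that are dense and free of
    colour conflicts, even pairwise.  All edges inside blocks then have distinct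
    colours, so any choice of tilings of the individual blocks is rainbow. *)
Lemma rainbow_tiling (R : realType) (l q m : nat) (mu d : R) (V W : finType)
    (H : hypergraph (l + q) W) (G : hypergraph (l + q) V)
    (C : eqType) (col : {set V} -> C) (Cf : seq C) :
  (0 < m)%N -> (1 < l + q)%N -> (l + q <= m.+1)%N ->
  (m.+1 %| #|V|)%N -> (#|W| %| m.+1)%N -> (0 < (#|V|.-1 - m.+1) ^_ m)%N ->
  (#|V| ^ m <= 2 * (#|V|.-1 - m.+1) ^_ m)%N ->
  0 <= mu -> mu_bounded mu G col -> mu * (512 * 4 ^ m * m.+1`!)%:R <= 1 ->
  admissible l H m.+1 d ->
  (forall v, #|[set U : {set V} | [&& #|U| == m.+1, v \in U
        & sparse l G (d * m.+1%:R ^+ q) U || color_bad G col Cf U]]|%:R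
      <= (16 * m.+1%:R)^-1 * ('C(#|V|.-1, m))%:R :> R) ->
  exists T, [/\ tiling H G [set: V] T, {in tiling_edges T &, injective col}
    & {in tiling_edges T, forall e, col e \notin Cf}].
Proof.
move=> m0 r1 rm mV Wm ff0 nm mu0 bd muS adm bad.
have K20 : (0 < 'C(#|V|.-1 - m.+1, m))%N by rewrite bin_gt0 -ffact_gt0.
have K10 : (0 < 'C(#|V|.-1, m))%N.
  by apply: leq_trans K20 _; rewrite leq_bin2l // leq_subr.
have [v|M [MV b1 b2]] := @good_partition R m V
    (fun U => sparse l G (d * m.+1%:R ^+ q) U || color_bad G col Cf U)
    (color_clash G col) mV K20 (@color_clash_sym _ _ G _ col).
  have h1 : #|[set U : {set V} | [&& #|U| == m.+1, v \in U
        & sparse l G (d * m.+1%:R ^+ q) U || color_bad G col Cf U]]|%:R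
       / ('C(#|V|.-1, m))%:R <= (16 * m.+1%:R)^-1 :> R.
    by rewrite ler_pdivrMr ?ltr0n.
  have h2 : 2 * #|[set u : {set V} * {set V} |
            [&& #|u.1| == m.+1, #|u.2| == m.+1, v \in u.1, [disjoint u.1 & u.2]
              & color_clash G col u.1 u.2]]|%:R
       / ('C(#|V|.-1, m) * 'C(#|V|.-1 - m.+1, m))%:R <= (16 * m.+1%:R)^-1 :> R.
    rewrite ler_pdivrMr ?ltr0n ?muln_gt0 ?K10 //.
    have hc := card_color_clash v rm (ltnW r1) mu0 bd.
    apply: (@le_trans _ _ (2 * (('C(#|V|.-1, m) * 2 ^ m.+1)%:R * mu
        * (2 * ('C(#|V|.-1 - m.+1, m) * m`!)%:R)))).
      rewrite ler_wpM2l //; apply: le_trans hc _; rewrite ler_wpM2l ?mulr_ge0 //.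
      by rewrite -natrX -natrM ler_nat bin_ffact.
    rewrite [leRHS]mulrC ler_pdivlMr; last by rewrite mulr_gt0.
    have le24 : (2 ^ m)%:R <= (4 ^ m)%:R :> R by rewrite ler_nat leq_exp2r.
    have T0 : 0 <= mu * ('C(#|V|.-1, m) * 'C(#|V|.-1 - m.+1, m) * m`! * m.+1)%:R.
      by rewrite mulr_ge0.
    have h3 := ler_wpM2l T0 le24.
    have h4 := ler_wpM2l (ler0n R ('C(#|V|.-1, m) * 'C(#|V|.-1 - m.+1, m))) muS.
    have T1 : 0 <= mu * ('C(#|V|.-1, m) * 'C(#|V|.-1 - m.+1, m) * m`! * m.+1 * 4 ^ m)%:R.
      by rewrite mulr_ge0.
    move: h3 h4 T1; rewrite factS expnS !natrM.
    by lra.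
  apply: le_trans (lerD h1 h2) _; rewrite !invfM; move: (m.+1%:R^-1) => y; lra.
have /mpartsP[pM cM] := MV.
have [|T [tT sT]] := @tiling_of_parts _ W V H G M (partition_trivIset pM).
  move=> U UM; have Um := cM _ UM; apply: (@tiling_of_dense R l _ W V H G U d); rewrite ?Um //.
    by apply: leq_trans rm; exact: leq_addr.
  by move: (b1 _ UM); rewrite negb_or addKn => /andP[].
exists T; rewrite -(cover_partition pM); split=> //.
  move=> e e' eT e'T cc.
  have [U UM eU] := sT _ eT; have [U' U'M e'U'] := sT _ e'T.
  have [eG _] := tiling_edgesP tT eT; have [e'G _] := tiling_edgesP tT e'T.
  have [UU'|UU'] := eqVneq U U'.
    move: (b1 _ UM); rewrite negb_or => /andP[_]; apply: contraNeq => ee'.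
    apply/exists_inP; exists e => //; rewrite eU /=; apply/orP; right.
    by apply/exists_inP; exists e' => //; rewrite UU' e'U' eq_sym ee' cc eqxx.
  case/negP: (b2 _ _ UM U'M UU'); apply/exists_inP; exists e => //.
  by apply/exists_inP; exists e'; rewrite // eU e'U' cc eqxx.
move=> e eT; have [U UM eU] := sT _ eT; have [eG _] := tiling_edgesP tT eT.
move: (b1 _ UM); rewrite negb_or => /andP[_]; apply: contra => ce.
by apply/exists_inP; exists e => //; rewrite eU ce.
Qed.

(** * Rainbow factors from a single admissible order *)

(** Passing to at least half of the vertices costs at most a factor [2 ^+ r] in
    the boundedness parameter, whichever of the two conditions is considered. *)
Lemma mu_bounded_pullback (R : realType) (mu : R) r (X V : finType) (f : X -> V)
    (G : hypergraph r V) (C : eqType) (col : {set V} -> C) :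
  (0 < r)%N -> injective f -> 0 <= mu -> (#|V| <= 2 * #|X|)%N ->
  mu_bounded mu G col ->
  mu_bounded (2 ^+ r * mu) (pullback f G) (fun e : {set X} => col (f @: e)).
Proof.
move=> r0 fi mu0 VX bd c; have [bd1 bd2] := bd c; split.
  rewrite (card_pullback_edges G (fun e => col e == c) fi).
  apply: le_trans (_ : mu * #|V|%:R ^+ (r - 1) <= _).
    apply: le_trans bd1; rewrite ler_nat; apply: subset_leq_card.
    by apply/subsetP => e; rewrite !inE => /and3P[-> ->].
  rewrite [leRHS](_ : _ = mu * (2 ^+ r * #|X|%:R ^+ (r - 1))); last by ring.
  rewrite ler_wpM2l //.
  apply: le_trans (_ : (2 * #|X|%:R) ^+ (r - 1) <= _).
    by rewrite -natrM lerXn2r ?nnegrE // ler_nat.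
  rewrite exprMn ler_wpM2r ?exprn_ge0 //.
  by rewrite ler_weXn2l ?ler1n // leq_subr.
move=> I Ir.
rewrite (eq_card (_ : _ =i [set e in edges (pullback f G) |
    (fun e' => (col e' == c) && (f @: I \subset e')) (f @: e)])); last first.
  by move=> e; rewrite !inE imsetS_inj.
rewrite (card_pullback_edges G (fun e' => (col e' == c) && (f @: I \subset e')) fi).
apply: le_trans (_ : mu * #|V|%:R <= _).
  apply: le_trans (bd2 (f @: I) _); last by rewrite card_imset.
  rewrite ler_nat; apply: subset_leq_card.
  by apply/subsetP => e; rewrite !inE => /and3P[-> ->].
rewrite [leRHS](_ : _ = mu * (2 ^+ r * #|X|%:R)); last by ring.
rewrite ler_wpM2l //.
apply: le_trans (_ : 2 * #|X|%:R <= _); first by rewrite -natrM ler_nat.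
rewrite ler_wpM2r // -{1}[2]expr1; apply: ler_weXn2l; rewrite ?ler1n //.
Qed.

(** An edge on [S] that is lost meets [D], and few edges contain [S] and a
    given further point. *)
Lemma degree_le_induced (l q : nat) (V : finType) (G : hypergraph (l + q) V)
    (D S : {set V}) :
  #|S| = l -> [disjoint S & D] ->
  (degree G S <= induced_degree G (~: D) S + #|D| * #|V| ^ q.-1)%N.
Proof.
move=> Sl SD; pose E x := [set e : {set V} | x |: S \subset e & #|e| == (l + q)%N].
apply: leq_trans (_ : #|[set e in edges G | (S \subset e) && (e \subset ~: D)]
    :|: \bigcup_(x in D) E x| <= _)%N.
  apply: subset_leq_card; apply/subsetP => e; rewrite !inE => /andP[eG Se].
  rewrite eG Se /=; case: (boolP (e \subset ~: D)) => //= /subsetPn[x xe].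
  rewrite inE negbK => xD; apply/bigcupP; exists x => //.
  by rewrite inE subUset sub1set xe Se (edges_uniform eG) eqxx.
apply: leq_trans (leq_card_setU _ _) _; rewrite leq_add2l.
apply: leq_trans (card_bigcup_le _ _) _; rewrite -sum_nat_const.
apply: leq_sum => x xD; have := card_supersets (x |: S) (l + q).
have xS : x \notin S by rewrite (disjointFl SD xD).
by rewrite cardsU1 xS Sl (_ : (l + q - (1 + l) = q.-1)%N) //; lia.
Qed.

(** Reduction to orders divisible by the block size [m].  The remainder of [n]
    modulo [m] is a multiple [t * #|W|] with [t * #|W| < m].  Take one good
    block, keep [t] copies of its tiling, and tile the other vertices while
    avoiding all colours that occur in that block.  Removing fewer than [m]
    vertices changes the degrees by a vanishing proportion. *)
Lemma rainbow_factor_of_admissible (R : realType) (l q : nat) (eps : R) :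
  0 < eps -> eps <= 1 -> (0 < l)%N -> (0 < q)%N ->
  exists m0, forall m, (m0 <= m)%N -> exists n0, forall n, (n0 <= n)%N ->
  forall (W V : finType) (H : hypergraph (l + q) W) (G : hypergraph (l + q) V)
    (C : eqType) (col : {set V} -> C) (mu d al : R),
  #|V| = n -> (l + q <= #|W|)%N -> (#|W| %| m)%N -> (#|W| %| n)%N ->
  admissible l H m d -> d + eps / 2 <= al ->
  (forall S : {set V}, #|S| = l -> al * n%:R ^+ q <= (degree G S)%:R) ->
  0 <= mu -> mu * (2 ^ (l + q) * (512 * 4 ^ m * m`!))%:R <= 1 -> mu_bounded mu G col ->
  exists T, is_factor H G T /\ rainbow col T.
Proof.
move=> e0 e1 l0 q0.
have [||m0 hm0] := @sparse_rare R l q (eps / 4); [lra | lra |].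
exists (m0 + 2)%N; case=> [|m] mm0; first by lia.
have [n1 hn1] := exp_leq_twice_ffact m.
pose z := m.+1%:R / (eps / 4) : R.
exists (n1 + 2 * m.+1 + l + Num.truncn z + 1)%N => n nn0.
have [n1n n1n' ln zn] : [/\ n1 <= n - m.+1, n1 <= n, l <= n - m.+1 & Num.truncn z < n]%N.
  by move: nn0; move: (Num.truncn z) => ?; split; lia.
have [n0 mn ln' m_gt0 r1] : [/\ 0 < n, m < n, l <= n, 0 < m & 1 < l + q]%N by split; lia.
have sub_ge s : (s < m.+1 -> n - m.+1 <= n - s /\ n <= 2 * (n - s))%N by lia.
have mm0' : (m0 <= m)%N by lia.
clear nn0 mm0; move=> W V H G C col mu d al Vn rW Wm Wn adm dal degG mu0 muS bd.
have d0 : 0 <= d by case: adm.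
have W0 : (0 < #|W|)%N by apply: leq_trans rW; exact: ltnW.
have rm : (l + q <= m.+1)%N by apply: leq_trans rW (dvdn_leq _ Wm).
have muS1 : mu * (512 * 4 ^ m * m.+1`!)%:R <= 1.
  apply: le_trans muS; rewrite ler_wpM2l // ler_nat.
  apply: leq_trans (leq_pmull _ _); last by rewrite expn_gt0.
  by rewrite leq_mul2r leq_mul2l leq_exp2l // leqnSn !orbT.
have al0 : 0 <= al - eps / 4 by lra.
(* the block that supplies the copies absorbing the remainder of [n] modulo
   the block size *)
have /card_gt0P[v0 _] : (0 < #|V|)%N by rewrite Vn.
have [U0 [U0m dense0 good0]] : exists U : {set V}, [/\ #|U| = m.+1,
    ~~ sparse l G (d * m.+1%:R ^+ q) U & ~~ color_bad G col [::] U].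
  apply: (@exists_good_set R l q m _ V G C col v0); first by rewrite Vn.
  apply: (@bad_sets_rare R l q m mu) => //; first by rewrite Vn; exact: hn1.
  by apply: (hm0 _ mm0' V G al d); rewrite ?Vn //; [exact: hn1 | lra].
have [||||T0 tT0] := @tiling_of_dense R l _ W V H G U0 d.
- by rewrite U0m.
- by rewrite U0m.
- by rewrite U0m; apply: leq_trans rm; exact: leq_addr.
- by rewrite U0m addKn.
have [cT0 dT0 UT0] := tT0.
have T0m := tiling_card tT0; rewrite U0m in T0m.
pose t := ((n %% m.+1) %/ #|W|)%N.
have tW : (t * #|W| = n %% m.+1)%N.
  by rewrite divnK // /dvdn modn_dvdm.
have modm : (n %% m.+1 < m.+1)%N by rewrite ltn_mod.
have [T1 [T1T0 T1t]] : exists T1 : {set {set V} * {set {set V}}},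
    T1 \subset T0 /\ #|T1| = t.
  have : (0 < #|[set T1 : {set {set V} * {set {set V}}} | T1 \subset T0 & #|T1| == t]|)%N.
    rewrite cards_draws bin_gt0 -(leq_pmul2r W0) tW -T0m; exact: ltnW.
  by case/card_gt0P => T1; rewrite inE => /andP[? /eqP]; exists T1.
pose D := \bigcup_(c in T1) c.1.
have tT1 : tiling H G D T1 := subtiling tT0 T1T0.
have DU0 : D \subset U0.
  apply/subsetP => x /bigcupP[c /(subsetP T1T0) cin xc].
  by rewrite -UT0; apply/bigcupP; exists c.
have Dn : #|D| = (n %% m.+1)%N by rewrite (tiling_card tT1) T1t.
pose X : finType := {x : V | x \in ~: D}; pose f : X -> V := val.
have fi : injective f by exact: val_inj.
have fX : f @: [set: X] = ~: D.
  by apply/setP => x; apply/imsetP/idP => [[y _ ->]|xU]; [exact: valP | exists (Sub x xU)].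
have Xn : #|X| = (n - n %% m.+1)%N.
  by rewrite -cardsT -(card_imset _ fi) fX cardsCs setCK Dn Vn.
have [Xge nX] := sub_ge _ modm; rewrite -Xn in Xge nX.
have X_gt0 : (0 < #|X|)%N by rewrite -(ltn_pmul2l (_ : 0 < 2)%N) // muln0; exact: leq_trans nX.
have Xffact : (#|X| ^ m <= 2 * (#|X|.-1 - m.+1) ^_ m)%N by apply: hn1; exact: leq_trans Xge.
pose G' := pullback f G; pose col' (e : {set X}) := col (f @: e).
pose mu' : R := 2 ^+ (l + q) * mu.
have mu'0 : 0 <= mu' by rewrite mulr_ge0 // exprn_ge0.
have bd' : mu_bounded mu' G' col'.
  by apply: mu_bounded_pullback; rewrite ?Vn //; exact: ltnW.
have mu'S : mu' * (512 * 4 ^ m * m.+1`!)%:R <= 1.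
  apply: le_trans muS; rewrite /mu' -natrX mulrAC -natrM mulrC ler_wpM2l // ler_nat.
  by rewrite leq_mul2l leq_mul2r leq_mul2l leq_exp2l // leqnSn !orbT.
have n_gt0 : 0 < n%:R :> R by rewrite ltr0n.
have degG' (L : {set X}) : #|L| = l -> (al - eps / 4) * #|X|%:R ^+ q <= (degree G' L)%:R.
  move=> Ll; have Sl : #|f @: L| = l by rewrite card_imset.
  have SD : [disjoint f @: L & D].
    by rewrite disjoints_subset -fX imsetS ?finset.subsetT.
  have := degree_le_induced G Sl SD; rewrite -fX -degree_pullback //.
  rewrite -/G' Vn Dn -(ler_nat R) natrD => h1.
  have h2 := degG _ Sl.
  have h3 : (n %% m.+1 * n ^ q.-1)%:R <= eps / 4 * n%:R ^+ q :> R.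
    rewrite natrM natrX -[in leRHS](prednK q0) exprS mulrA ler_wpM2r ?exprn_ge0 //.
    apply: le_trans (_ : m.+1%:R <= _); first by rewrite ler_nat ltnW.
    rewrite mulrC -ler_pdivrMr; last by lra.
    by rewrite -/z; apply: ltW; apply: lt_le_trans (truncnS_gt _) _; rewrite ler_nat.
  have h4 : (al - eps / 4) * #|X|%:R ^+ q <= (al - eps / 4) * n%:R ^+ q.
    by rewrite ler_wpM2l // lerXn2r ?nnegrE // ler_nat Xn leq_subr.
  by apply: le_trans h4 _; lra.
pose Cf := [seq col e | e <- enum (powerset U0)].
have szC : (size Cf <= 2 ^ m.+1)%N by rewrite size_map -cardE card_powerset U0m.
have [||||||||||||T' [tT' rT' fT']] := @rainbow_tiling R l q m mu' d X W H G' C col' Cf.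
- by [].
- by [].
- by [].
- by rewrite Xn; apply/dvdnP; exists (n %/ m.+1)%N; rewrite {1}(divn_eq n m.+1) addnK.
- by [].
- by rewrite -(ltn_pmul2l (_ : 0 < 2)%N) // muln0; apply: leq_trans Xffact; rewrite expn_gt0 X_gt0.
- by [].
- by [].
- by [].
- by [].
- by [].
- move=> v; apply: (@bad_sets_rare R l q m mu') => //.
  by apply: (hm0 _ mm0' X G' (al - eps / 4) d) => //; [exact: leq_trans Xge | lra].
have tT2 := tiling_image fi tT'; rewrite fX in tT2.
set T2 := [set copy_image f c | c in T'] in tT2.
have dD : [disjoint D & ~: D] by rewrite -setI_eq0 setICr.
exists (T1 :|: T2); split.
  by apply: factor_of_tiling => //; rewrite -(setUCr D); exact: tilingU.
have edge1 e : e \in tiling_edges T1 -> e \in edges G /\ e \subset U0.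
  by move=> /(tiling_edgesP tT1)[eG eD]; split=> //; exact: subset_trans DU0.
have cross e e' : e \in tiling_edges T1 -> e' \in tiling_edges T2 -> col e != col e'.
  move=> /edge1[_ eU] /tiling_edges_image[e0' /fT' h ->]; apply: contraNneq h => ce.
  by rewrite /col' -ce; apply: map_f; rewrite mem_enum powersetE.
have edgesE : \bigcup_(c in T1 :|: T2) c.2 = tiling_edges T1 :|: tiling_edges T2.
  exact: tiling_edgesU.
move=> e e'; rewrite edgesE => /setUP[eT|eT] /setUP[e'T|e'T] ce.
- have [eG eU] := edge1 _ eT; have [e'G e'U] := edge1 _ e'T.
  move: good0; apply: contraNeq => ee'; apply/exists_inP; exists e => //.
  by rewrite eU /=; apply/exists_inP; exists e' => //; rewrite e'U eq_sym ee' ce eqxx.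
- by have := cross _ _ eT e'T; rewrite ce eqxx.
- by have := cross _ _ e'T eT; rewrite ce eqxx.
case/tiling_edges_image: eT ce => x xT ->; case/tiling_edges_image: e'T => y yT -> ce.
by rewrite (rT' _ _ xT yT).
Qed.

(** * Thresholds *)

(** Copies depend on the pattern only up to isomorphism, hence so do the
    thresholds below; this lets the patterns on [h] vertices range over a finite
    type. *)
Lemma is_copy_pullback r (I W V : finType) (g : I -> W) (H : hypergraph r W)
    (G : hypergraph r V) c :
  bijective g -> is_copy (pullback g H) G c <-> is_copy H G c.
Proof.
move=> gb; have [g' gK g'K] := gb; have gi := can_inj gK; have g'i := can_inj g'K.
have gT : g @: [set: I] = [set: W].
  by apply/setP => x; rewrite inE; apply/imsetP; exists (g' x); rewrite ?inE ?g'K.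
have HE : edges H = [set g @: (e : {set I}) | e in edges (pullback g H)].
  apply/setP => e; apply/idP/imsetP => [eH|[e' + ->]]; last by rewrite mem_pullback.
  have ge : g @: (g' @: e) = e.
    by rewrite -imset_comp -[RHS]imset_id; apply: eq_imset => x /=; exact: g'K.
  by exists (g' @: e); rewrite ?mem_pullback // ge.
split=> -[cG [f [fi c1 c2]]]; split=> //.
  exists (f \o g'); split; first exact: inj_comp.
    rewrite c1 -gT -imset_comp; apply: eq_imset => x /=; by rewrite gK.
  rewrite c2 HE -imset_comp; apply: eq_imset => e /=.
  by rewrite -imset_comp; apply: eq_imset => x /=; rewrite gK.
exists (f \o g); split; first exact: inj_comp.
  by rewrite c1 -gT -imset_comp.
by rewrite c2 HE -imset_comp; apply: eq_imset => e /=; rewrite -imset_comp.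
Qed.

Lemma is_factor_pullback r (I W V : finType) (g : I -> W) (H : hypergraph r W)
    (G : hypergraph r V) T :
  bijective g -> is_factor (pullback g H) G T <-> is_factor H G T.
Proof.
move=> gb; rewrite /is_factor (bij_eq_card gb).
by split=> -[cT dT nT]; split=> // c /cT /(is_copy_pullback _ _ _ gb).
Qed.

Lemma admissible_pullback (R : realType) l r (I W : finType) (g : I -> W)
    (H : hypergraph r W) n (d : R) :
  bijective g -> admissible l (pullback g H) n d <-> admissible l H n d.
Proof.
move=> gb; split=> -[d0 adm]; split=> // V G Vn h.
  by have [T /(is_factor_pullback _ _ _ gb)] := adm V G Vn h; exists T.
by have [T /(is_factor_pullback _ _ _ gb)] := adm V G Vn h; exists T.
Qed.

Lemma threshold_pullback (R : realType) l r (I W : finType) (g : I -> W)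
    (H : hypergraph r W) :
  bijective g -> threshold R l (pullback g H) = threshold R l H.
Proof.
move=> gb; rewrite /threshold (bij_eq_card gb); congr limn_inf.
apply/funext => k; rewrite /threshold_at; congr inf.
by apply/seteqP; split=> d /= /(@admissible_pullback R l r I W g H _ d gb).
Qed.

(** A minimum [l]-degree never exceeds the [q]-th power of the order. *)
Lemma admissible1 (R : realType) l q (W : finType) (H : hypergraph (l + q) W) n :
  (0 < q)%N -> admissible l H n (1 : R).
Proof.
move=> q0; split=> // V G Vn; rewrite mul1r addKn -natrX ltr_nat ltnNge => /negP[].
have [ln|ln] := leqP l n.
  have [S Sl] : exists S : {set V}, #|S| = l.
    have : (0 < #|[set S : {set V} | #|S| == l]|)%N by rewrite card_draws bin_gt0 Vn.
    by case/card_gt0P => S; rewrite inE => /eqP; exists S.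
  have /(@min_degreeP l _ V G (min_degree l G)) : (l <= #|V|)%N by rewrite Vn.
  case=> /(_ (leqnn _)) /(_ S Sl) h _; apply: leq_trans h _.
  rewrite -Vn; apply: leq_trans (@card_link_le _ q V G S _); last by rewrite Sl.
  by rewrite leq_pmulr // fact_gt0.
apply: leq_trans (min_degree_le l G) _.
suff -> : edges G = set0 by rewrite cards0.
apply/setP => e; rewrite inE; apply/negP => /edges_uniform er.
by have := max_card (mem e); rewrite er Vn leqNgt ltn_addr.
Qed.

Lemma threshold_at_bounds (R : realType) l q (W : finType) (H : hypergraph (l + q) W) n :
  (0 < q)%N -> 0 <= threshold_at R l H n <= 1.
Proof.
move=> q0; have ad1 := @admissible1 R l q W H n q0; apply/andP; split.
  by apply: lb_le_inf => [|d []//]; exists 1.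
by apply: ge_inf => //; exists 0 => d [].
Qed.

(** Since the sequence is bounded, its inferior limit is the supremum of the
    infima of its tails, so arbitrarily late terms come close to it from above.
    The factor theorem needs only one such late term. *)
Lemma threshold_approx (R : realType) l q (W : finType) (H : hypergraph (l + q) W)
    (eps : R) N : (0 < q)%N -> 0 < eps ->
  exists2 k, (N <= k)%N & threshold_at R l H (k * #|W|) < threshold R l H + eps.
Proof.
move=> q0 e0; pose u k := threshold_at R l H (k * #|W|).
have ub k : 0 <= u k <= 1 by exact: threshold_at_bounds.
have bu : bounded_fun u.
  exists 1; split=> // x x1 k _ /=; have /andP[u0 u1] := ub k.
  by rewrite ger0_norm //; apply: le_trans u1 (ltW x1).
have le_ : infs u N <= threshold R l H.
  rewrite /threshold -/u limn_infE //; apply: ub_le_sup; last by exists N.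
  exact: bounded_fun_has_ubound_infs.
have : infs u N < threshold R l H + eps by apply: le_lt_trans le_ _; lra.
rewrite /infs /= => /inf_lt[]; first by exists (u N); exists N => /=.
by move=> _ [k /= Nk <-] h; exists k.
Qed.

(** Discarding the sets of wrong size turns every set system into an
    [r]-uniform hypergraph, so hypergraphs on a fixed vertex set are indexed by a
    finite type. *)
Definition uniform_part_edges r (V : finType) (E : {set {set V}}) : {set {set V}} :=
  [set e in E | #|e| == r].

Lemma uniform_part_uniform r (V : finType) (E : {set {set V}}) :
  {in uniform_part_edges r E, forall e : {set V}, #|e| = r}.
Proof. by move=> e; rewrite inE => /andP[_ /eqP]. Qed.

Definition uniform_part r (V : finType) (E : {set {set V}}) : hypergraph r V :=
  Hypergraph (@uniform_part_uniform r V E).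

Lemma uniform_part_edgesK r (V : finType) (H : hypergraph r V) :
  uniform_part r (edges H) = H.
Proof.
case: H => E uE; rewrite /uniform_part.
have eE : uniform_part_edges r E = E.
  by apply/setP => e; rewrite inE; apply: andb_idr => /uE/eqP.
move: (@uniform_part_uniform r V E); rewrite /= eE => u'.
by congr Hypergraph; exact: Prop_irrelevance.
Qed.

Theorem theorem1p2 (R : realType) (l r h : nat)
  (hl : (1 <= l)%N) (hlr : (l < r)%N) (hrh : (r <= h)%N) :
  exists eps0 : R, 0 < eps0 /\
  forall eps : R, 0 < eps -> eps < eps0 ->
  exists mu0 : R, 0 < mu0 /\
  forall mu : R, 0 < mu -> mu < mu0 ->
  exists n0 : nat,
  forall n : nat, (n0 <= n)%N -> (h %| n)%N ->
  forall (W : finType) (H : hypergraph r W), #|W| = h ->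
  forall (V : finType) (G : hypergraph r V), #|V| = n ->
    (threshold R l H + eps) * n%:R ^+ (r - l) <= (min_degree l G)%:R ->
  forall (C : eqType) (col : {set V} -> C), mu_bounded mu G col ->
  exists T : {set {set V} * {set {set V}}}, is_factor H G T /\ rainbow col T.
Proof.
have [q rE] : exists q, r = (l + q)%N by exists (r - l)%N; lia.
subst r; have q0 : (0 < q)%N by lia.
exists 1; split=> // eps e0 e1.
have [m0 hm0] := @rainbow_factor_of_admissible R l q eps e0 (ltW e1) hl q0.
have h0 : (0 < h)%N by lia.
(* the block size [k E * h] depends on the isomorphism type of the pattern;
   [mu0] and the order bound are uniform because there are finitely many *)
have approx (E : {set {set 'I_h}}) : exists k, (m0.+1 <= k)%N /\
    threshold_at R l (uniform_part (l + q) E) (k * h)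
      < threshold R l (uniform_part (l + q) E) + eps / 2.
  have [|k] := @threshold_approx R l q _ (uniform_part (l + q) E) (eps / 2) m0.+1 q0.
    lra.
  by rewrite card_ord; exists k.
have [k hk] := choice approx.
have mk E : (m0 <= k E * h)%N.
  by have [km _] := hk E; apply: leq_trans (leq_pmulr _ h0); exact: ltnW.
pose wt m := (2 ^ (l + q) * (512 * 4 ^ m * m`!))%N.
have wt0 m : (0 < wt m)%N by rewrite !muln_gt0 !expn_gt0 fact_gt0.
pose S := (\max_(E : {set {set 'I_h}}) wt (k E * h))%N.
exists (S.+1%:R^-1); split; first by rewrite invr_gt0 ltr0n.
move=> mu mu_gt0 mu_lt.
have [n1 hn1] := choice (fun E => hm0 _ (mk E)).
exists (\max_(E : {set {set 'I_h}}) n1 E + l)%N => n nn hn W H Wh V G Vn degG C col bd.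
have [g gb] : exists g : 'I_h -> W, bijective g.
  exists (fun i => enum_val (cast_ord (esym Wh) i)).
  exists (fun w => cast_ord Wh (enum_rank w)) => x.
    by rewrite enum_valK cast_ordKV.
  by rewrite cast_ordK enum_rankK.
pose E := edges (pullback g H).
have HE : uniform_part (l + q) E = pullback g H by exact: uniform_part_edgesK.
have [_ thrE] := hk E; rewrite HE threshold_pullback // in thrE.
have m_pos : (0 < k E * h)%N by rewrite muln_gt0 h0 andbT; have [] := hk E; lia.
have adm : admissible l H (k E * h) (threshold_at R l (pullback g H) (k E * h)).
  by apply/(@admissible_pullback R l _ _ _ g H _ _ gb);
    have [] := threshold_at_min R l (pullback g H) m_pos.
have n1E : (n1 E <= n)%N.
  by apply: leq_trans (leq_trans (leq_addr _ _) nn); exact: leq_bigmax.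
have ln : (l <= #|V|)%N by rewrite Vn; apply: leq_trans nn; exact: leq_addl.
apply: (hn1 E n n1E W V H G C col mu _ (threshold R l H + eps) Vn _ _ _ adm) => //.
- by rewrite Wh.
- by rewrite Wh dvdn_mull.
- by rewrite Wh.
- by lra.
- move=> L Ll; move: degG; rewrite addKn => /le_trans; apply; rewrite ler_nat.
  by have /(@min_degreeP l _ V G (min_degree l G)) [/(_ (leqnn _)) hm _] := ln; exact: hm.
- exact: ltW.
apply: (@le_trans _ _ (mu * S.+1%:R)).
  rewrite ler_wpM2l ?(ltW mu_gt0) // ler_nat -/(wt _); apply: leqW.
  exact: (@leq_bigmax _ (fun E => wt (k E * h)%N)).
by rewrite -ler_pdivlMr ?ltr0n // div1r ltW.
Qed.
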